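(* (i) Let $h:\mathbb{R}\to\mathbb{R}$ be three times differentiable with $\|h'''\|_\infty<\infty$. For $r\ge1$ let $Z_r$ be a random variable with law $\widetilde\mu^{(r)}$ and let $Y$ be a standard normal random variable. Then \[\big|\mathbb{E}(h(Z_r))-\mathbb{E}(h(Y))\big| = O\!\left(\frac{1}{\sqrt{\rho(r)}}\right)\quad\text{as }\rho(r)\to\infty.\] (ii) Let $F_r$ be the cumulative distribution function of $\widetilde\mu^{(r)}$ and $F$ that of $\mathcal{N}(0,1)$. There is a constant $\widetilde K>0$ (depending only on $b$) such that for every integer $r\ge1$, \[\sup_{t\in\mathbb{R}}|F_r(t)-F(t)|\le \frac{\widetilde K}{\rho(r)^{1/8}}.\]
   Context: Fix an integer $b\ge 2$. For $n\in\mathbb{N}$ with base-$b$ digits $n_k\in\{0,\dots,b-1\}$, $s(n):=\sum_k n_k$. For $r,n\in\mathbb{N}$, $\Delta^{(r)}(n):=s(n+r)-s(n)$ and $\mu^{(r)}(d):=\lim_{N\to\infty}\frac1N|\{n<N:\Delta^{(r)}(n)=d\}|$ ($d\in\mathbb{Z}$); these limits exist and $\mu^{(r)}$ is a probability measure on $\mathbb{Z}$ with finite moments. For $r\ge1$, $\sigma_r:=\sqrt{\mathrm{Var}(\mu^{(r)})}>0$ and $\widetilde\mu^{(r)}$ is the probability measure on $\mathbb{R}$ supported on $\{d/\sigma_r:d\in\mathbb{Z}\}$ with $\widetilde\mu^{(r)}(\{d/\sigma_r\})=\mu^{(r)}(d)$. Blocks: write the expansion of $r\ge1$ as the digit string $r_\ell\cdots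 r_0$, $r_\ell\ne0$. A block is either a maximal run of consecutive $0$ digits, or a maximal run of consecutive digits equal to $b-1$, or (when $b\ge3$) a single digit with value in $\{1,\dots,b-2\}$; $\rho(r)$ is the number of blocks of $r$. *)

(* Defs.v *)
From Stdlib Require Import Reals Lra Lia ZArith Arith List.
From Coquelicot Require Import Coquelicot.
Open Scope R_scope.

(* digits of n in base b, least significant first; the fuel n suffices
   for b >= 2 since n < b^n. *)
Fixpoint digits_aux (b fuel n : nat) : list nat :=
  match fuel with
  | O => nil
  | S f => if Nat.eqb n 0 then nil else (n mod b)%nat :: digits_aux b f (n / b)
  end.
Definition digits (b n : nat) : list nat := digits_aux b n n.

Definition sdig (b n : nat) : nat := fold_right Nat.add 0%nat (digits b n).

Definition Delta (b r n : nat) : Z :=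
  (Z.of_nat (sdig b (n + r)) - Z.of_nat (sdig b n))%Z.

Definition freq (b r : nat) (d : Z) (N : nat) : R :=
  INR (length (filter (fun n => Z.eqb (Delta b r n) d) (seq 0 N))) / INR N.

(* mu^{(r)}(d) = lim_{N->oo} freq (the limit exists, by the paper) *)
Definition mu (b r : nat) (d : Z) : R := real (Lim_seq (fun N => freq b r d N)).

Definition zsum (f : Z -> R) : R :=
  Series (fun k => f (Z.of_nat k)) + Series (fun k => f (- Z.of_nat (S k))%Z).

Definition mean_mu (b r : nat) : R := zsum (fun d => IZR d * mu b r d).
Definition var_mu (b r : nat) : R :=
  zsum (fun d => (IZR d - mean_mu b r) ^ 2 * mu b r d).
Definition sigma (b r : nat) : R := sqrt (var_mu b r).

(* E h(Z_r) for Z_r with law mu~^{(r)} (atoms d/sigma_r with mass mu^{(r)}(d)) *)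
Definition E_tilde (b r : nat) (h : R -> R) : R :=
  zsum (fun d => mu b r d * h (IZR d / sigma b r)).

Definition F_tilde (b r : nat) (t : R) : R :=
  zsum (fun d => if Rle_dec (IZR d / sigma b r) t then mu b r d else 0).

Definition phi (x : R) : R := exp (- x ^ 2 / 2) / sqrt (2 * PI).
Definition E_normal (h : R -> R) : R :=
  RInt_gen (fun x => h x * phi x) (Rbar_locally m_infty) (Rbar_locally p_infty).
Definition F_normal (t : R) : R :=
  RInt_gen phi (Rbar_locally m_infty) (at_point t).

Definition dclass (b x : nat) : nat :=
  if Nat.eqb x 0 then 0 else if Nat.eqb x (b - 1) then 1 else 2.

(* a digit starts a new block iff it is the first digit, or it is a
   "middle" digit (single-digit block), or its class differs from the
   previous digit's class *)
Definition new_block (b : nat) (prev : option nat) (x : nat) : bool :=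
  match prev with
  | None => true
  | Some y => Nat.eqb (dclass b x) 2 || negb (Nat.eqb (dclass b x) (dclass b y))
  end.

Fixpoint nblocks (b : nat) (prev : option nat) (l : list nat) : nat :=
  match l with
  | nil => 0
  | x :: l' => ((if new_block b prev x then 1 else 0) + nblocks b (Some x) l')%nat
  end.

Definition rho (b r : nat) : nat := nblocks b None (digits b r).

(* Main.v *)
From Stdlib Require Import Reals Lra Lia ZArith Arith List.
From Coquelicot Require Import Coquelicot.
Require Import Defs.
Open Scope R_scope.

(** Splitting off the lowest digit, [r = b q + a], gives
    [mu_r = (b-a)/b delta_a * mu_q + a/b delta_(a-b) * mu_(q+1)].
    Hence [mu_r] has mean zero and its variance [V_r] satisfies
    [V_r = (b-a)/b V_q + a/b V_(q+1) + a (b-a)]. Following the digits from the top,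
    each block made of a nonzero digit or of digits [b-1] raises the variance by at
    least 1, so [V_r >= rho(r) / 2].

    The normal approximation is Stein's method carried out along this recursion:
    [|V_r E_r f' - E_r (x f)| <= C |f''| V_r] by induction on [r]. In the induction step
    the first-order terms cancel because of the variance recursion, once [E_q] and
    [E_(q+1)] are known to differ by [O(|f''|)] on [f]. If [f' - x f = h - E h(Y)], then
    [w = f''] solves [w'' - x w' - 3 w = h'''], and the maximum principle gives
    [|f''| <= |h'''| / 3], even though [h] itself may have cubic growth. This yields the
    error [O(|h'''| / sqrt(rho))]; for the distribution functions one smooths the
    indicator at scale [rho^(-1/8)]. *)

(** * The densities mu *)

(** Runs of [0] or of [b-1] may be arbitrarily long and still count as one block, so an error
    proportional to the number of digits would be useless. The Stein estimate is therefore stated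
    with an error proportional to the variance. This is consistent because a digit [a] produces a
    remainder of order [|f''| a (b - a)], and [a (b - a)] is exactly the source term of the variance
    recursion. The recursion mixes [q] and [q + 1], whose laws must be compared although [f] may
    grow quadratically. On the normal side only [h'''] is controlled, so neither [h] nor the
    solution [f] is bounded. Differentiating the Stein equation until the right-hand side is [h''']
    creates the term [- 3 w], and this coefficient is what yields a bound on [w] once polynomial
    growth is known. *)

Lemma digits_aux_fuel (b : nat) (hb : (2 <= b)%nat) (f g n : nat) :
  (n <= f)%nat -> (n <= g)%nat -> digits_aux b f n = digits_aux b g n.
Proof.
  revert g n; induction f as [|f IH]; intros [|g] n Hf Hg; simpl; auto.
  - replace n with 0%nat by lia. reflexivity.
  - replace n with 0%nat by lia. reflexivity.
  - destruct (Nat.eqb_spec n 0) as [->|Hn]; auto.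
    f_equal. assert (n / b < n)%nat by (apply Nat.div_lt; lia).
    apply IH; lia.
Qed.

Lemma digits_rec (b r a : nat) (hb : (2 <= b)%nat) :
  (a < b)%nat -> (0 < b * r + a)%nat -> digits b (b * r + a) = a :: digits b r.
Proof.
  intros Ha Hp. unfold digits at 1.
  destruct (b * r + a)%nat as [|m] eqn:E; [lia|].
  cbn [digits_aux]. change (Nat.eqb (S m) 0) with false. cbv iota.
  rewrite <- E. f_equal.
  - rewrite (Nat.mul_comm b r), Nat.add_comm, Nat.Div0.mod_add; apply Nat.mod_small; lia.
  - replace ((b * r + a) / b)%nat with r.
    + apply digits_aux_fuel; nia.
    + symmetry. rewrite (Nat.mul_comm b r), Nat.div_add_l, Nat.div_small; lia.
Qed.

Lemma sdig_rec (b n j : nat) (hb : (2 <= b)%nat) :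
  (j < b)%nat -> sdig b (b * n + j) = (sdig b n + j)%nat.
Proof.
  intros Hj. destruct (Nat.eq_dec (b * n + j) 0) as [E|E].
  - rewrite E. replace n with 0%nat by nia. replace j with 0%nat by lia.
    unfold sdig; simpl; lia.
  - unfold sdig at 1. rewrite digits_rec by lia. simpl. unfold sdig. lia.
Qed.

Lemma Delta_no_carry (b r a n j : nat) (hb : (2 <= b)%nat) :
  (j + a < b)%nat ->
  Delta b (b * r + a) (b * n + j) = (Delta b r n + Z.of_nat a)%Z.
Proof.
  intros H. unfold Delta.
  replace (b * n + j + (b * r + a))%nat with (b * (n + r) + (j + a))%nat by ring.
  rewrite !sdig_rec by lia. lia.
Qed.

(** The carry acts on the higher digits as the addition of [r + 1] in place of [r], and it costs [b]
    in the last digit. *)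
Lemma Delta_carry (b r a n j : nat) (hb : (2 <= b)%nat) :
  (j < b)%nat -> (a < b)%nat -> (b <= j + a)%nat ->
  Delta b (b * r + a) (b * n + j)
  = (Delta b (r + 1) n + Z.of_nat a - Z.of_nat b)%Z.
Proof.
  intros Hj Ha H. unfold Delta.
  replace (b * n + j + (b * r + a))%nat
    with (b * (n + (r + 1)) + (j + a - b))%nat by nia.
  rewrite !sdig_rec by lia. lia.
Qed.

Lemma Delta_0 (b n : nat) : Delta b 0 n = 0%Z.
Proof. unfold Delta. rewrite Nat.add_0_r. lia. Qed.

(** Carries only lower the digit sum. The upper bound gives the self-referring recursion of [r = 1]
    a starting point. *)
Lemma Delta_1_le (b n : nat) (hb : (2 <= b)%nat) : (Delta b 1 n <= 1)%Z.
Proof.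
  induction n as [n IH] using (well_founded_induction lt_wf).
  pose proof (Nat.div_mod_eq n b) as E.
  assert (Hm : (n mod b < b)%nat) by (apply Nat.mod_upper_bound; lia).
  set (q := (n / b)%nat) in *. set (j := (n mod b)%nat) in *.
  rewrite E. replace 1%nat with (b * 0 + 1)%nat at 1 by lia.
  destruct (Nat.lt_ge_cases (j + 1) b) as [H|H].
  - rewrite Delta_no_carry, Delta_0 by lia. simpl; lia.
  - rewrite Delta_carry by lia. simpl (0 + 1)%nat.
    assert (q < n)%nat by nia. specialize (IH q H0). lia.
Qed.

Definition cnt (b r : nat) (d : Z) (N : nat) : nat :=
  length (filter (fun n => Z.eqb (Delta b r n) d) (seq 0 N)).

Lemma length_filter_const {A : Type} (P : A -> bool) (c : bool) (l : list A) :
  (forall x, In x l -> P x = c) -> length (filter P l) = ((if c then 1 else 0) * length l)%nat.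
Proof.
  induction l as [|x l IH]; intros H; simpl; [lia|].
  rewrite (H x (or_introl eq_refl)).
  rewrite <- (Nat.add_1_l (length l)).
  destruct c; simpl; rewrite IH; try lia; intros y Hy; apply H; now right.
Qed.

Lemma cnt_add (b r : nat) (d : Z) (N k : nat) :
  cnt b r d (N + k)
  = (cnt b r d N + length (filter (fun n => Z.eqb (Delta b r n) d) (seq N k)))%nat.
Proof. unfold cnt. rewrite seq_app, filter_app, length_app. reflexivity. Qed.

Lemma cnt_S (b r : nat) (d : Z) (N : nat) :
  cnt b r d (S N) = (cnt b r d N + if Z.eqb (Delta b r N) d then 1 else 0)%nat.
Proof.
  rewrite <- Nat.add_1_r, cnt_add. simpl. destruct (Z.eqb _ _); reflexivity.
Qed.

(** Among the [b] integers with a common quotient, the first [b - a] add the digit [a] without a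
    carry and the last [a] with one. *)
Lemma cnt_rec (b r a : nat) (d : Z) (N : nat) (hb : (2 <= b)%nat) :
  (a < b)%nat ->
  cnt b (b * r + a) d (b * N)
  = ((b - a) * cnt b r (d - Z.of_nat a) N
     + a * cnt b (r + 1) (d - Z.of_nat a + Z.of_nat b) N)%nat.
Proof.
  intros Ha. induction N as [|N IH].
  - rewrite Nat.mul_0_r. unfold cnt; simpl; lia.
  - rewrite Nat.mul_succ_r, cnt_add, IH, !cnt_S.
    assert (Es : seq (b * N) b = (seq (b * N) (b - a) ++ seq (b * N + (b - a)) a)%list).
    { rewrite <- seq_app. f_equal. lia. }
    rewrite Es, filter_app, length_app.
    rewrite (length_filter_const _ (Z.eqb (Delta b r N) (d - Z.of_nat a)))
      with (l := seq (b * N) (b - a)).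
    rewrite (length_filter_const _
      (Z.eqb (Delta b (r + 1) N) (d - Z.of_nat a + Z.of_nat b))).
    + rewrite !length_seq. ring.
    + intros x Hx. apply in_seq in Hx.
      replace x with (b * N + (x - b * N))%nat by lia.
      rewrite Delta_carry by lia.
      destruct (Z.eqb_spec (Delta b (r + 1) N) (d - Z.of_nat a + Z.of_nat b));
      [apply Z.eqb_eq|apply Z.eqb_neq]; lia.
    + intros x Hx. apply in_seq in Hx.
      replace x with (b * N + (x - b * N))%nat by lia.
      rewrite Delta_no_carry by lia.
      destruct (Z.eqb_spec (Delta b r N) (d - Z.of_nat a));
      [apply Z.eqb_eq|apply Z.eqb_neq]; lia.
Qed.

Lemma cnt_le (b r : nat) (d : Z) (N : nat) : (cnt b r d N <= N)%nat.
Proof.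
  unfold cnt. rewrite <- (length_seq N 0) at 2. apply filter_length_le.
Qed.

Lemma cnt_add_bounds (b r : nat) (d : Z) (N k : nat) :
  (cnt b r d N <= cnt b r d (N + k) <= cnt b r d N + k)%nat.
Proof.
  rewrite cnt_add. split; [lia|].
  rewrite <- (length_seq k N) at 2. apply Nat.add_le_mono_l, filter_length_le.
Qed.

Lemma freq_bounds (b r : nat) (d : Z) (N : nat) : 0 <= freq b r d N <= 1.
Proof.
  unfold freq. fold (cnt b r d N).
  pose proof (le_INR _ _ (cnt_le b r d N)) as H.
  pose proof (pos_INR (cnt b r d N)) as H0.
  destruct N as [|N].
  - change (cnt b r d 0) with 0%nat. unfold Rdiv; simpl; rewrite Rmult_0_l; lra.
  - assert (0 < INR (S N)) by (apply lt_0_INR; lia).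
    split; [apply Rdiv_le_0_compat; lra|].
    apply Rle_div_l; lra.
Qed.

(* A count up to [M] and up to the multiple of [b] below [M] differ by at most [b]. *)
Lemma freq_lim_of_subseq (b r : nat) (d : Z) (l : R) (hb : (2 <= b)%nat) :
  is_lim_seq (fun N => freq b r d (b * N)) l -> is_lim_seq (freq b r d) l.
Proof.
  intros H.
  assert (Hq : filterlim (fun n => (n / b)%nat) eventually eventually).
  { intros P [N HN]. exists (b * N)%nat. intros n Hn. apply HN.
    apply Nat.div_le_lower_bound; lia. }
  pose proof (filterlim_comp _ _ _ _ _ _ _ _ Hq H) as H1.
  assert (H2 : is_lim_seq (fun M => freq b r d M - freq b r d (b * (M / b))) 0).
  { apply is_lim_seq_le_le_loc with (u := fun M => - (2 * INR b * / INR M))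
      (w := fun M => 2 * INR b * / INR M).
    - exists (S b). intros M HM.
      pose proof (Nat.div_mod_eq M b) as E.
      assert (Hm : (M mod b < b)%nat) by (apply Nat.mod_upper_bound; lia).
      assert (Hq1 : (1 <= M / b)%nat) by (apply Nat.div_le_lower_bound; lia).
      set (q := (M / b)%nat) in *. set (j := (M mod b)%nat) in *.
      pose proof (freq_bounds b r d (b * q)) as Hf.
      unfold freq in *. fold (cnt b r d M) in *. fold (cnt b r d (b * q)) in *.
      destruct (cnt_add_bounds b r d (b * q) j) as [B1 B2].
      rewrite <- E in B1, B2.
      apply le_INR in B1, B2. rewrite plus_INR in B2.
      assert (Hbq : 0 < INR (b * q)) by (apply lt_0_INR; nia).
      assert (EM : INR M = INR (b * q) + INR j) by (rewrite E at 1; apply plus_INR).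
      assert (Hj : INR j <= INR b) by (apply le_INR; lia).
      assert (Hj0 := pos_INR j).
      set (x := INR (cnt b r d M)) in *. set (y := INR (cnt b r d (b * q))) in *.
      set (m := INR (b * q)) in *.
      assert (HM0 : 0 < INR M) by lra.
      (* Both [x - y] and [INR j * (y / m)] lie between [0] and [b], since [y / m] is a
         frequency. *)
      assert (Eq : x / INR M - y / m = ((x - y) - INR j * (y / m)) * / INR M).
      { rewrite EM. field. lra. }
      rewrite Eq. assert (Hi : 0 < / INR M) by now apply Rinv_0_lt_compat.
      split; [rewrite <- Ropp_mult_distr_l_reverse|]; apply Rmult_le_compat_r; nra.
    - replace (Finite 0) with (Rbar_opp (Rbar_mult (2 * INR b) 0)).
      apply -> is_lim_seq_opp. apply is_lim_seq_scal_l.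
      replace (Finite 0) with (Rbar_inv p_infty) by reflexivity.
      apply is_lim_seq_inv; [apply is_lim_seq_INR|discriminate].
      simpl; f_equal; ring.
    - replace (Finite 0) with (Rbar_mult (2 * INR b) 0) by (simpl; f_equal; ring).
      apply is_lim_seq_scal_l.
      replace (Finite 0) with (Rbar_inv p_infty) by reflexivity.
      apply is_lim_seq_inv; [apply is_lim_seq_INR|discriminate]. }
  apply is_lim_seq_ext with
    (fun M => (freq b r d M - freq b r d (b * (M / b))) + freq b r d (b * (M / b))).
  { intros n; ring. }
  replace l with (0 + l) by ring.
  apply is_lim_seq_plus'; assumption.
Qed.

(** For [a = 0] the second law has weight zero, and the disjunction asks nothing of it. This avoids
    a circle: in base 2 the number [r = 2] has quotient 1, so that [q + 1] is [r] itself. *)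
Lemma freq_rec_lim (b r a : nat) (d : Z) (l1 l2 : R) (hb : (2 <= b)%nat) :
  (a < b)%nat ->
  is_lim_seq (freq b r (d - Z.of_nat a)) l1 ->
  (a = 0%nat \/ is_lim_seq (freq b (r + 1) (d - Z.of_nat a + Z.of_nat b)) l2) ->
  is_lim_seq (freq b (b * r + a) d)
    ((INR b - INR a) / INR b * l1 + INR a / INR b * l2).
Proof.
  intros Ha H1 H2. apply freq_lim_of_subseq; auto.
  assert (Hb : 0 < INR b) by (apply lt_0_INR; lia).
  apply is_lim_seq_ext_loc with (fun N =>
    (INR b - INR a) / INR b * freq b r (d - Z.of_nat a) N
    + INR a / INR b * freq b (r + 1) (d - Z.of_nat a + Z.of_nat b) N).
  { exists 1%nat. intros N HN. unfold freq.
    fold (cnt b r (d - Z.of_nat a) N).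
    fold (cnt b (r + 1) (d - Z.of_nat a + Z.of_nat b) N).
    fold (cnt b (b * r + a) d (b * N)).
    rewrite cnt_rec by auto. rewrite plus_INR, !mult_INR, minus_INR by lia.
    assert (0 < INR N) by (apply lt_0_INR; lia). field; lra. }
  apply is_lim_seq_plus'.
  - apply (is_lim_seq_scal_l _ _ l1 H1).
  - destruct H2 as [->|H2].
    + simpl. apply is_lim_seq_ext with (fun _ => 0).
      intros n; unfold Rdiv; ring.
      replace (0 / INR b * l2) with 0 by (unfold Rdiv; ring). apply is_lim_seq_const.
    + apply (is_lim_seq_scal_l _ _ l2 H2).
Qed.

Lemma freq_const_lim (b r : nat) (d : Z) (c : bool) :
  (forall n, Z.eqb (Delta b r n) d = c) ->
  is_lim_seq (freq b r d) (Finite (if c then 1 else 0)).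
Proof.
  intros H. apply is_lim_seq_ext_loc with (fun _ => if c then 1 else 0).
  - exists 1%nat. intros N HN. unfold freq.
    rewrite (length_filter_const _ c) by auto. rewrite length_seq, mult_INR.
    assert (0 < INR N) by (apply lt_0_INR; lia).
    destruct c; simpl; field; lra.
  - apply is_lim_seq_const.
Qed.

Lemma freq_0_lim (b : nat) (d : Z) :
  is_lim_seq (freq b 0 d) (Finite (if Z.eqb 0 d then 1 else 0)).
Proof. apply freq_const_lim. intros n. now rewrite Delta_0. Qed.

(** Here the recursion keeps [r = 1] but moves [d] up by [b - 1], hence the induction on [2 - d];
    above [d = 1] the frequency vanishes. *)
Lemma freq_1_ex_lim (b : nat) (d : Z) (hb : (2 <= b)%nat) :
  exists l : R, is_lim_seq (freq b 1 d) l.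
Proof.
  remember (Z.to_nat (2 - d)) as k eqn:Hk. revert d Hk.
  induction k as [k IH] using (well_founded_induction lt_wf). intros d Hk.
  destruct (Z_lt_le_dec 1 d) as [Hd|Hd].
  - exists 0. apply (freq_const_lim b 1 d false). intros n.
    apply Z.eqb_neq. pose proof (Delta_1_le b n hb). lia.
  - destruct (IH (Z.to_nat (2 - (d - Z.of_nat 1 + Z.of_nat b)))) with
      (d := (d - Z.of_nat 1 + Z.of_nat b)%Z) as [l Hl]; [lia|reflexivity|].
    eexists. replace 1%nat with (b * 0 + 1)%nat at 1 by lia.
    apply freq_rec_lim; [auto|lia|apply freq_0_lim|right; exact Hl].
Qed.

(* Only [r = 1] has a recursion that refers back to itself. *)
Lemma base_ind (b : nat) (hb : (2 <= b)%nat) (P : nat -> Prop) :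
  P 0%nat -> P 1%nat ->
  (forall r a, (a < b)%nat -> (1 < b * r + a)%nat -> P r ->
     (a = 0%nat \/ P (r + 1)%nat) -> P (b * r + a)%nat) ->
  forall r, P r.
Proof.
  intros P0 P1 PS r. induction r as [r IH] using (well_founded_induction lt_wf).
  destruct r as [|[|r]]; auto. set (n := S (S r)) in *.
  pose proof (Nat.div_mod_eq n b) as E.
  assert (Hm : (n mod b < b)%nat) by (apply Nat.mod_upper_bound; lia).
  set (q := (n / b)%nat) in *. set (j := (n mod b)%nat) in *.
  rewrite E. apply PS; auto; try (unfold n in *; lia).
  - apply IH. unfold n in *; nia.
  - destruct (Nat.eq_dec j 0); [left; auto|right]. apply IH. unfold n in *; nia.
Qed.

Lemma freq_ex_lim (b : nat) (hb : (2 <= b)%nat) (r : nat) :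
  forall d, exists l : R, is_lim_seq (freq b r d) l.
Proof.
  revert r. apply (base_ind b hb (fun r => forall d, exists l : R, is_lim_seq (freq b r d) l)).
  - intros d. eexists; apply freq_0_lim.
  - intros d. now apply freq_1_ex_lim.
  - intros r a Ha _ IH1 IH2 d.
    destruct (IH1 (d - Z.of_nat a)%Z) as [l1 H1].
    destruct IH2 as [Z0|IH2].
    + exists ((INR b - INR a) / INR b * l1 + INR a / INR b * 0).
      apply freq_rec_lim; auto.
    + destruct (IH2 (d - Z.of_nat a + Z.of_nat b)%Z) as [l2 H2].
      eexists. apply freq_rec_lim; eauto.
Qed.

Lemma mu_lim (b r : nat) (d : Z) (hb : (2 <= b)%nat) :
  is_lim_seq (freq b r d) (mu b r d).
Proof.
  destruct (freq_ex_lim b hb r d) as [l Hl]. unfold mu.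
  rewrite (is_lim_seq_unique (fun N => freq b r d N) _ Hl). exact Hl.
Qed.

Lemma mu_unique (b r : nat) (d : Z) (l : R) :
  is_lim_seq (freq b r d) l -> mu b r d = l.
Proof. intros H. unfold mu. now rewrite (is_lim_seq_unique (fun N => freq b r d N) _ H). Qed.

Lemma mu_0 (b : nat) (d : Z) : mu b 0 d = if Z.eqb 0 d then 1 else 0.
Proof. apply mu_unique, freq_0_lim. Qed.

Lemma mu_nonneg (b r : nat) (d : Z) (hb : (2 <= b)%nat) : 0 <= mu b r d.
Proof.
  apply (is_lim_seq_le (fun _ => 0) (freq b r d) 0 (mu b r d)).
  - intros n. apply freq_bounds.
  - apply is_lim_seq_const.
  - now apply mu_lim.
Qed.

Lemma mu_rec (b r a : nat) (d : Z) (hb : (2 <= b)%nat) :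
  (a <= b)%nat ->
  mu b (b * r + a) d
  = (INR b - INR a) / INR b * mu b r (d - Z.of_nat a)
    + INR a / INR b * mu b (r + 1) (d - Z.of_nat a + Z.of_nat b).
Proof.
  intros Ha. destruct (Nat.eq_dec a b) as [->|Hab].
  - assert (0 < INR b) by (apply lt_0_INR; lia).
    replace (b * r + b)%nat with (b * (r + 1) + 0)%nat by ring.
    replace (d - Z.of_nat b + Z.of_nat b)%Z with (d - Z.of_nat 0)%Z by lia.
    transitivity ((INR b - INR 0) / INR b * mu b (r + 1) (d - Z.of_nat 0)
                  + INR 0 / INR b * 0).
    + apply mu_unique, freq_rec_lim; auto; try lia. now apply mu_lim.
    + simpl. field. lra.
  - apply mu_unique, freq_rec_lim; auto; try lia; [|right]; now apply mu_lim.
Qed.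

Lemma mu_1_eq0 (b : nat) (d : Z) (hb : (2 <= b)%nat) : (1 < d)%Z -> mu b 1 d = 0.
Proof.
  intros H. apply mu_unique, (freq_const_lim b 1 d false). intros n.
  apply Z.eqb_neq. pose proof (Delta_1_le b n hb). lia.
Qed.

(** * Expectations under mu *)

Definition ex_zsum (f : Z -> R) : Prop :=
  ex_series (fun k => f (Z.of_nat k)) /\ ex_series (fun k => f (- Z.of_nat (S k))%Z).

Lemma zsum_ext (f g : Z -> R) : (forall d, f d = g d) -> zsum f = zsum g.
Proof. intros H. unfold zsum. f_equal; apply Series_ext; intros; apply H. Qed.

Lemma ex_zsum_ext (f g : Z -> R) : (forall d, f d = g d) -> ex_zsum f -> ex_zsum g.
Proof.
  intros H [H1 H2].
  split; [apply ex_series_ext with (2 := H1)|apply ex_series_ext with (2 := H2)];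
  intros n; apply H.
Qed.

Lemma ex_zsum_plus (f g : Z -> R) :
  ex_zsum f -> ex_zsum g -> ex_zsum (fun d => f d + g d).
Proof.
  intros [F1 F2] [G1 G2].
  split; [exact (ex_series_plus _ _ F1 G1)|exact (ex_series_plus _ _ F2 G2)].
Qed.

Lemma zsum_plus (f g : Z -> R) :
  ex_zsum f -> ex_zsum g -> zsum (fun d => f d + g d) = zsum f + zsum g.
Proof.
  intros [F1 F2] [G1 G2]. unfold zsum. rewrite !Series_plus by assumption. ring.
Qed.

Lemma ex_zsum_scal (c : R) (f : Z -> R) : ex_zsum f -> ex_zsum (fun d => c * f d).
Proof.
  intros [F1 F2]. split; [exact (ex_series_scal c _ F1)|exact (ex_series_scal c _ F2)].
Qed.

Lemma zsum_scal (c : R) (f : Z -> R) : zsum (fun d => c * f d) = c * zsum f.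
Proof. unfold zsum. rewrite !Series_scal_l. ring. Qed.

Lemma ex_zsum_le (f g : Z -> R) :
  (forall d, Rabs (f d) <= g d) -> ex_zsum g -> ex_zsum f.
Proof.
  intros H [G1 G2].
  split; [apply @ex_series_le with (2 := G1)|apply @ex_series_le with (2 := G2)];
  intros n; apply H.
Qed.

Lemma zsum_nonneg (f : Z -> R) : ex_zsum f -> (forall d, 0 <= f d) -> 0 <= zsum f.
Proof.
  intros [F1 F2] H.
  assert (Z0 : Series (fun _ => 0) = 0).
  { rewrite (Series_ext _ (fun _ => 0 * 0)) by (intros; ring).
    rewrite Series_scal_l. ring. }
  unfold zsum.
  assert (0 <= Series (fun k => f (Z.of_nat k))).
  { rewrite <- Z0. apply Series_le; [intros n; split; [lra|apply H]|assumption]. }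
  assert (0 <= Series (fun k => f (- Z.of_nat (S k))%Z)).
  { rewrite <- Z0. apply Series_le; [intros n; split; [lra|apply H]|assumption]. }
  lra.
Qed.

Lemma zsum_le (f g : Z -> R) :
  ex_zsum f -> ex_zsum g -> (forall d, f d <= g d) -> zsum f <= zsum g.
Proof.
  intros F G H.
  assert (0 <= zsum (fun d => g d + (-1) * f d)).
  { apply zsum_nonneg; [apply ex_zsum_plus, ex_zsum_scal; assumption|].
    intros d; specialize (H d); lra. }
  rewrite zsum_plus, zsum_scal in H0; auto using ex_zsum_scal. lra.
Qed.

Lemma zsum_shift1 (f : Z -> R) :
  ex_zsum f -> ex_zsum (fun d => f (d + 1)%Z) /\ zsum (fun d => f (d + 1)%Z) = zsum f.
Proof.
  intros [F1 F2].
  assert (E1 : forall k, f (Z.of_nat k + 1)%Z = f (Z.of_nat (S k))) by (intros; f_equal; lia).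
  assert (E2 : forall k, f (- Z.of_nat (S k) + 1)%Z = f (- Z.of_nat k)%Z) by (intros; f_equal; lia).
  assert (X1 : ex_series (fun k => f (Z.of_nat (S k)))) by (apply (ex_series_incr_1 (fun k => f (Z.of_nat k))), F1).
  assert (X2 : ex_series (fun k => f (- Z.of_nat k)%Z)) by (apply (ex_series_incr_1 (fun k => f (- Z.of_nat k)%Z)), F2).
  split.
  - split; [eapply ex_series_ext; [|exact X1]|eapply ex_series_ext; [|exact X2]];
    intros; symmetry; auto.
  - unfold zsum. rewrite (Series_ext _ _ E1), (Series_ext _ _ E2).
    rewrite (Series_incr_1 _ F1), (Series_incr_1 _ X2). simpl (- Z.of_nat 0)%Z.
    simpl (Z.of_nat 0). ring.
Qed.

Lemma zsum_shift_m1 (f : Z -> R) :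
  ex_zsum f -> ex_zsum (fun d => f (d + - 1)%Z) /\ zsum (fun d => f (d + - 1)%Z) = zsum f.
Proof.
  intros [F1 F2].
  assert (E2 : forall k, f (- Z.of_nat (S k) + - 1)%Z = f (- Z.of_nat (S (S k)))%Z)
    by (intros; f_equal; lia).
  assert (X2 : ex_series (fun k => f (- Z.of_nat (S (S k)))%Z))
    by (apply (ex_series_incr_1 (fun k => f (- Z.of_nat (S k))%Z)), F2).
  assert (X1 : ex_series (fun k => f (Z.of_nat k + - 1)%Z)).
  { apply (ex_series_incr_1 (fun k => f (Z.of_nat k + - 1)%Z)).
    eapply ex_series_ext; [|exact F1]. intros; cbv beta; f_equal; lia. }
  split.
  - split; [exact X1|]. eapply ex_series_ext; [|exact X2]. intros; symmetry; auto.
  - unfold zsum. rewrite (Series_ext _ _ E2).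
    rewrite (Series_incr_1 _ F2), (Series_incr_1 _ X1).
    rewrite (Series_ext (fun k => f (Z.of_nat (S k) + - 1)%Z) (fun k => f (Z.of_nat k)))
      by (intros; f_equal; lia).
    simpl (- Z.of_nat 1)%Z. simpl (Z.of_nat 0 + - 1)%Z. ring.
Qed.

Lemma zsum_shift (z : Z) (f : Z -> R) :
  ex_zsum f -> ex_zsum (fun d => f (d + z)%Z) /\ zsum (fun d => f (d + z)%Z) = zsum f.
Proof.
  intros H. induction z as [|z [IH1 IH2]|z [IH1 IH2]] using Z.peano_ind.
  - split; [eapply ex_zsum_ext; [|exact H]|apply zsum_ext]; intros; f_equal; lia.
  - destruct (zsum_shift1 _ IH1) as [A1 A2]. split.
    + eapply ex_zsum_ext; [|exact A1]. intros; cbv beta; f_equal; lia.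
    + rewrite <- IH2, <- A2. apply zsum_ext. intros; f_equal; lia.
  - destruct (zsum_shift_m1 _ IH1) as [A1 A2]. split.
    + eapply ex_zsum_ext; [|exact A1]. intros; cbv beta; f_equal; lia.
    + rewrite <- IH2, <- A2. apply zsum_ext. intros; f_equal; lia.
Qed.

Lemma ex_series_cubic_geom (q : R) :
  0 < q < 1 -> ex_series (fun k => (1 + INR k) ^ 3 * q ^ k).
Proof.
  intros Hq. apply ex_series_Rabs, ex_series_DAlembert with q; [lra| |].
  - intros n. apply Rgt_not_eq. apply Rmult_lt_0_compat; apply pow_lt; try lra.
    pose proof (pos_INR n); lra.
  - apply is_lim_seq_ext with (fun n => (1 + / (1 + INR n)) ^ 3 * q).
    + intros n. pose proof (pos_INR n).
      assert (Hp : 0 < q ^ n) by (apply pow_lt; lra).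
      rewrite S_INR, Rabs_pos_eq.
      * simpl (q ^ S n). field. lra.
      * apply Rdiv_le_0_compat.
        -- apply Rmult_le_pos; apply pow_le; lra.
        -- apply Rmult_lt_0_compat; [apply pow_lt; lra|assumption].
    + replace (Finite q) with (Finite ((1 + 0) * ((1 + 0) * ((1 + 0) * 1)) * q)) by (f_equal; ring).
      assert (L : is_lim_seq (fun n => 1 + / (1 + INR n)) (1 + 0)).
      { apply is_lim_seq_plus'; [apply is_lim_seq_const|].
        replace (Finite 0) with (Rbar_inv p_infty) by reflexivity.
        apply is_lim_seq_inv; [|discriminate].
        apply is_lim_seq_ext with (fun n => INR (n + 1)).
        intros n; rewrite plus_INR; simpl; ring.
        apply (is_lim_seq_incr_n INR 1), is_lim_seq_INR. }
      simpl.
      repeat apply is_lim_seq_mult'; try assumption; apply is_lim_seq_const.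
Qed.

Lemma ex_zsum_cubic_geom (q : R) : 0 < q < 1 ->
  ex_zsum (fun d => (1 + Rabs (IZR d)) ^ 3 * q ^ Z.abs_nat d).
Proof.
  intros Hq. pose proof (ex_series_cubic_geom q Hq) as H. split.
  - eapply ex_series_ext; [|exact H]. intros n. simpl.
    rewrite <- INR_IZR_INZ, Rabs_pos_eq by apply pos_INR.
    now rewrite Zabs2Nat.id.
  - apply (ex_series_incr_1 (fun n => (1 + INR n) ^ 3 * q ^ n)) in H.
    eapply ex_series_ext; [|exact H]. intros n.
    rewrite opp_IZR, Rabs_Ropp, <- INR_IZR_INZ, Rabs_pos_eq by apply pos_INR.
    now replace (Z.abs_nat (- Z.of_nat (S n))) with (S n) by lia.
Qed.

Lemma pow_le_1 (q : R) (n : nat) : 0 <= q <= 1 -> q ^ n <= 1.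
Proof. intros. rewrite <- (pow1 n). apply pow_incr; lra. Qed.

Lemma Bernoulli_sub (x : R) (n : nat) : 0 <= x <= 1 -> 1 - INR n * x <= (1 - x) ^ n.
Proof.
  intros Hx. induction n as [|n IH]; [simpl; lra|].
  rewrite S_INR. simpl.
  assert (0 <= (1 - x) ^ n <= 1).
  { split; [apply pow_le|apply pow_le_1]; lra. }
  nra.
Qed.

Lemma pow_antitone (q : R) (m n : nat) : 0 <= q <= 1 -> (m <= n)%nat -> q ^ n <= q ^ m.
Proof.
  intros Hq Hmn. replace n with (m + (n - m))%nat by lia. rewrite pow_add.
  rewrite <- (Rmult_1_r (q ^ m)) at 2.
  apply Rmult_le_compat_l; [apply pow_le; lra|now apply pow_le_1].
Qed.

(** * Geometric decay of the laws *)

Section Law.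
Variable b : nat.
Hypothesis hb : (2 <= b)%nat.

Let b_pos : 2 <= INR b.
Proof. apply (le_INR 2); assumption. Qed.

(** A further carry has probability [1 / b] and lowers the value by [b - 1]. The rate
    [q = 1 - 1 / b] is chosen because Bernoulli's inequality gives [1 / b <= q ^ (b - 1)], so one
    carry costs no more than the bound allows. *)
Lemma mu_1_geom (d : Z) : (d <= 1)%Z -> mu b 1 d <= (1 - / INR b) ^ Z.to_nat (1 - d).
Proof.
  assert (Hq : 0 < / INR b <= / 2).
  { split; [apply Rinv_0_lt_compat; lra|apply Rinv_le_contravar; lra]. }
  remember (Z.to_nat (1 - d)) as k eqn:Hk. revert d Hk.
  induction k as [k IH] using (well_founded_induction lt_wf). intros d Hk Hd.
  assert (E : mu b 1 d = (INR b - INR 1) / INR b * mu b 0 (d - Z.of_nat 1)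
     + INR 1 / INR b * mu b (0 + 1) (d - Z.of_nat 1 + Z.of_nat b)).
  { rewrite <- mu_rec by lia. do 2 f_equal. lia. }
  rewrite E, mu_0. simpl (0 + 1)%nat.
  set (q := 1 - / INR b) in *.
  assert (Hqk : 0 <= q ^ k) by (apply pow_le; unfold q; lra).
  destruct (Z.eqb_spec 0 (d - Z.of_nat 1)) as [D|D].
  - replace k with 0%nat by lia. rewrite mu_1_eq0 by lia.
    replace ((INR b - INR 1) / INR b * 1 + INR 1 / INR b * 0) with (1 - / INR b)
      by (simpl; field; lra).
    simpl; lra.
  - destruct (Z_lt_le_dec 1 (d - Z.of_nat 1 + Z.of_nat b)) as [L|L].
    + rewrite mu_1_eq0 by lia. lra.
    + specialize (IH (Z.to_nat (1 - (d - Z.of_nat 1 + Z.of_nat b)))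
        ltac:(lia) _ eq_refl L).
      assert (Hbq : / INR b <= q ^ (b - 1)).
      { eapply Rle_trans; [|apply Bernoulli_sub; lra].
        rewrite minus_INR by lia. simpl. apply Req_le. field. lra. }
      replace k with ((b - 1) + Z.to_nat (1 - (d - Z.of_nat 1 + Z.of_nat b)))%nat by lia.
      rewrite pow_add. simpl (INR 1). unfold Rdiv. rewrite Rmult_0_r, Rplus_0_l, Rmult_1_l.
      apply Rmult_le_compat; try lra. now apply mu_nonneg.
Qed.

(** A translation by [z] changes the bound only by the factor [q ^ (- |z|)], so the rate is kept
    through the recursion. The constant may depend on [r], since the lemma serves only for
    convergence of the sums. *)
Lemma mu_geom (r : nat) :
  exists C, 0 <= C /\ forall d, mu b r d <= C * (1 - / INR b) ^ Z.abs_nat d.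
Proof.
  assert (Hb' : 0 < / INR b <= / 2).
  { split; [apply Rinv_0_lt_compat; lra|apply Rinv_le_contravar; lra]. }
  set (q := 1 - / INR b). assert (Hq : / 2 <= q < 1) by (unfold q; lra).
  assert (Sh : forall d z, q ^ Z.abs_nat (d + z) <= / q ^ Z.abs_nat z * q ^ Z.abs_nat d).
  { intros d z. assert (0 < q ^ Z.abs_nat z) by (apply pow_lt; lra).
    apply Rmult_le_reg_l with (q ^ Z.abs_nat z); [assumption|].
    rewrite <- Rmult_assoc, Rinv_r, Rmult_1_l by lra.
    rewrite <- pow_add. apply pow_antitone; [lra|lia]. }
  revert r. apply (base_ind b hb (fun r => exists C, 0 <= C /\ forall d, mu b r d <= C * q ^ Z.abs_nat d)).
  - exists 1. split; [lra|]. intros d. rewrite mu_0.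
    destruct (Z.eqb_spec 0 d) as [<-|]; simpl; [lra|].
    rewrite Rmult_1_l. apply pow_le; lra.
  - exists 2. split; [lra|]. intros d.
    assert (0 < q ^ Z.abs_nat d) by (apply pow_lt; lra).
    destruct (Z_lt_le_dec 1 d) as [L|L]; [rewrite mu_1_eq0; auto; lra|].
    eapply Rle_trans; [now apply mu_1_geom|]. fold q.
    destruct (Z.eq_dec d 1) as [->|].
    + simpl. lra.
    + assert (q ^ Z.to_nat (1 - d) <= q ^ Z.abs_nat d) by (apply pow_antitone; [lra|lia]).
      lra.
  - intros r a Ha _ [C1 [P1 H1]] IH2.
    assert (X : exists C2, 0 <= C2 /\ forall d,
      INR a / INR b * mu b (r + 1) d <= C2 * q ^ Z.abs_nat d).
    { assert (0 <= INR a / INR b) by (apply Rdiv_le_0_compat; [apply pos_INR|lra]).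
      destruct IH2 as [->|[C2 [P2 H2]]].
      - exists 0. split; [lra|]. intros d. simpl. unfold Rdiv. lra.
      - exists (INR a / INR b * C2). split; [now apply Rmult_le_pos|].
        intros d. rewrite Rmult_assoc. now apply Rmult_le_compat_l. }
    destruct X as [C2 [P2 H2]].
    assert (Hab : 0 <= (INR b - INR a) / INR b).
    { apply Rdiv_le_0_compat; [|lra]. apply lt_INR in Ha. lra. }
    assert (Pq : forall z, 0 < / q ^ Z.abs_nat z) by (intros; apply Rinv_0_lt_compat, pow_lt; lra).
    set (z1 := (- Z.of_nat a)%Z). set (z2 := (- Z.of_nat a + Z.of_nat b)%Z).
    exists ((INR b - INR a) / INR b * C1 * / q ^ Z.abs_nat z1 + C2 * / q ^ Z.abs_nat z2).
    split.
    { pose proof (Pq z1). pose proof (Pq z2).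
      apply Rplus_le_le_0_compat; apply Rmult_le_pos; try lra. apply Rmult_le_pos; lra. }
    intros d. rewrite mu_rec by lia. rewrite Rmult_plus_distr_r.
    replace (d - Z.of_nat a)%Z with (d + z1)%Z by (unfold z1; lia).
    replace (d + z1 + Z.of_nat b)%Z with (d + z2)%Z by (unfold z1, z2; lia).
    apply Rplus_le_compat.
    + rewrite !Rmult_assoc. apply Rmult_le_compat_l; [assumption|].
      eapply Rle_trans; [apply H1|]. apply Rmult_le_compat_l; [assumption|apply Sh].
    + eapply Rle_trans; [apply H2|]. rewrite Rmult_assoc.
      apply Rmult_le_compat_l; [assumption|apply Sh].
Qed.

End Law.

(** * Test functions of cubic growth *)

(** Degree three is what both sides of the argument produce: [h] with bounded [h'''], and [x f] with
    bounded [f'']. *)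
Definition cubic (f : R -> R) : Prop := exists A, forall x, Rabs (f x) <= A * (1 + Rabs x) ^ 3.

Lemma one_le_cube (x : R) : 1 <= (1 + Rabs x) ^ 3.
Proof. apply pow_R1_Rle. pose proof (Rabs_pos x); lra. Qed.

Lemma cubic_le (f g : R -> R) : (forall x, Rabs (f x) <= Rabs (g x)) -> cubic g -> cubic f.
Proof. intros H [A HA]. exists A. intros x. eapply Rle_trans; eauto. Qed.

Lemma cubic_ext (f g : R -> R) : (forall x, f x = g x) -> cubic g -> cubic f.
Proof. intros H. apply cubic_le. intros x; rewrite H; lra. Qed.

Lemma cubic_abs (f : R -> R) : cubic f -> cubic (fun x => Rabs (f x)).
Proof. apply cubic_le. intros; rewrite Rabs_Rabsolu; lra. Qed.

Lemma cubic_plus (f g : R -> R) : cubic f -> cubic g -> cubic (fun x => f x + g x).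
Proof.
  intros [A HA] [B HB]. exists (A + B). intros x.
  rewrite Rmult_plus_distr_r. eapply Rle_trans; [apply Rabs_triang|].
  apply Rplus_le_compat; auto.
Qed.

Lemma cubic_scal (c : R) (f : R -> R) : cubic f -> cubic (fun x => c * f x).
Proof.
  intros [A HA]. exists (Rabs c * A). intros x. rewrite Rabs_mult, Rmult_assoc.
  apply Rmult_le_compat_l; [apply Rabs_pos|auto].
Qed.

Lemma cubic_minus (f g : R -> R) : cubic f -> cubic g -> cubic (fun x => f x - g x).
Proof.
  intros F G. apply cubic_ext with (fun x => f x + (-1) * g x); [intros; ring|].
  apply cubic_plus, cubic_scal; assumption.
Qed.

Lemma cubic_const (c : R) : cubic (fun _ => c).
Proof.
  exists (Rabs c). intros x. pose proof (one_le_cube x). pose proof (Rabs_pos c). nra.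
Qed.

Lemma cubic_pow (n : nat) : (n <= 3)%nat -> cubic (fun x => x ^ n).
Proof.
  intros Hn. exists 1. intros x. rewrite Rmult_1_l, <- RPow_abs.
  apply Rle_trans with ((1 + Rabs x) ^ n).
  - apply pow_incr. pose proof (Rabs_pos x); lra.
  - apply Rle_pow; [pose proof (Rabs_pos x); lra|assumption].
Qed.

Lemma cubic_id : cubic (fun x => x).
Proof. apply cubic_ext with (fun x => x ^ 1); [intros; ring|apply cubic_pow; lia]. Qed.

Lemma cubic_affine (s c : R) (f : R -> R) : cubic f -> cubic (fun x => f (s * x + c)).
Proof.
  intros [A HA]. exists (Rabs A * ((1 + Rabs s) * (1 + Rabs c)) ^ 3). intros x.
  eapply Rle_trans; [apply HA|].
  apply Rle_trans with (Rabs A * (1 + Rabs (s * x + c)) ^ 3).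
  { apply Rmult_le_compat_r; [pose proof (one_le_cube (s * x + c)); lra|apply Rle_abs]. }
  rewrite Rmult_assoc. apply Rmult_le_compat_l; [apply Rabs_pos|].
  rewrite <- Rpow_mult_distr. apply pow_incr.
  pose proof (Rabs_pos (s * x + c)). split; [lra|].
  pose proof (Rabs_triang (s * x) c). rewrite Rabs_mult in H0.
  pose proof (Rabs_pos s). pose proof (Rabs_pos c). pose proof (Rabs_pos x).
  assert (0 <= Rabs s * Rabs c) by nra.
  assert (0 <= Rabs c * Rabs x) by nra.
  assert (0 <= Rabs s * Rabs x) by nra.
  assert (0 <= Rabs s * Rabs c * Rabs x) by (apply Rmult_le_pos; lra).
  nra.
Qed.

Lemma cubic_shift (c : R) (f : R -> R) : cubic f -> cubic (fun x => f (x + c)).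
Proof.
  intros H. apply cubic_ext with (fun x => f (1 * x + c)); [intros; f_equal; ring|].
  now apply cubic_affine.
Qed.

Definition Emu (b r : nat) (f : R -> R) : R := zsum (fun d => mu b r d * f (IZR d)).

Section Expectation.
Variable b : nat.
Hypothesis hb : (2 <= b)%nat.

Lemma ex_Emu (r : nat) (f : R -> R) : cubic f -> ex_zsum (fun d => mu b r d * f (IZR d)).
Proof.
  intros [A HA]. destruct (mu_geom b hb r) as [C [HC H]].
  assert (B : 2 <= INR b) by (apply (le_INR 2); assumption).
  assert (Hq : 0 < / INR b <= / 2).
  { split; [apply Rinv_0_lt_compat; lra|apply Rinv_le_contravar; lra]. }
  apply ex_zsum_le with
    (fun d => (C * A) * ((1 + Rabs (IZR d)) ^ 3 * (1 - / INR b) ^ Z.abs_nat d)).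
  - intros d. rewrite Rabs_mult, Rabs_pos_eq by now apply mu_nonneg.
    replace (C * A * ((1 + Rabs (IZR d)) ^ 3 * (1 - / INR b) ^ Z.abs_nat d))
      with (C * (1 - / INR b) ^ Z.abs_nat d * (A * (1 + Rabs (IZR d)) ^ 3)) by ring.
    apply Rmult_le_compat; auto using Rabs_pos. now apply mu_nonneg.
  - apply ex_zsum_scal, ex_zsum_cubic_geom. lra.
Qed.

Lemma Emu_ext (r : nat) (f g : R -> R) : (forall x, f x = g x) -> Emu b r f = Emu b r g.
Proof. intros H. apply zsum_ext. intros; now rewrite H. Qed.

Lemma Emu_plus (r : nat) (f g : R -> R) : cubic f -> cubic g ->
  Emu b r (fun x => f x + g x) = Emu b r f + Emu b r g.
Proof.
  intros F G. unfold Emu. rewrite <- zsum_plus by now apply ex_Emu.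
  apply zsum_ext. intros; ring.
Qed.

Lemma Emu_scal (r : nat) (c : R) (f : R -> R) : Emu b r (fun x => c * f x) = c * Emu b r f.
Proof. unfold Emu. rewrite <- zsum_scal. apply zsum_ext. intros; ring. Qed.

Lemma Emu_minus (r : nat) (f g : R -> R) : cubic f -> cubic g ->
  Emu b r (fun x => f x - g x) = Emu b r f - Emu b r g.
Proof.
  intros F G. rewrite (Emu_ext _ _ (fun x => f x + (-1) * g x)) by (intros; ring).
  rewrite Emu_plus, Emu_scal; auto using cubic_scal. ring.
Qed.

Lemma Emu_le (r : nat) (f g : R -> R) : cubic f -> cubic g ->
  (forall x, f x <= g x) -> Emu b r f <= Emu b r g.
Proof.
  intros F G H. apply zsum_le; try now apply ex_Emu.
  intros d. apply Rmult_le_compat_l; [now apply mu_nonneg|apply H].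
Qed.

Lemma Emu_abs_le (r : nat) (f g : R -> R) : cubic f -> cubic g ->
  (forall x, Rabs (f x) <= g x) -> Rabs (Emu b r f) <= Emu b r g.
Proof.
  intros F G H. apply Rabs_le. split.
  - rewrite <- (Rmult_1_l (Emu b r g)), Ropp_mult_distr_l, <- Emu_scal.
    apply Emu_le; auto using cubic_scal. intros x.
    specialize (H x). apply Rabs_le_between in H. lra.
  - apply Emu_le; auto. intros x. specialize (H x). apply Rabs_le_between in H. lra.
Qed.

Lemma Emu_0 (f : R -> R) : Emu b 0 f = f 0.
Proof.
  unfold Emu, zsum.
  assert (S1 : is_series (fun k => mu b 0 (Z.of_nat k) * f (IZR (Z.of_nat k))) (f 0)).
  { apply (is_lim_seq_ext (fun _ => f 0) _ (Finite (f 0))); [|apply is_lim_seq_const].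
    intros n. induction n as [|n IH].
    - rewrite sum_O, mu_0. simpl. ring.
    - rewrite sum_Sn, <- IH, mu_0. simpl. unfold plus; simpl. ring. }
  rewrite (is_series_unique _ _ S1).
  rewrite (Series_ext _ (fun _ => 0 * 0)).
  - rewrite Series_scal_l. ring.
  - intros n. rewrite mu_0.
    replace (Z.eqb 0 (- Z.of_nat (S n))) with false. ring.
    symmetry. apply Z.eqb_neq. lia.
Qed.

(** The dual form of [mu_rec]: a carry occurs with probability [a / b], and the shift is [a] without
    it and [a - b] with it. *)
Lemma Emu_rec (r a : nat) (f : R -> R) : (a <= b)%nat -> cubic f ->
  Emu b (b * r + a) f
  = (INR b - INR a) / INR b * Emu b r (fun x => f (x + INR a))
    + INR a / INR b * Emu b (r + 1) (fun x => f (x + (INR a - INR b))).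
Proof.
  intros Ha F. unfold Emu.
  destruct (zsum_shift (- Z.of_nat a) _ (ex_Emu r _ (cubic_shift (INR a) f F))) as [X1 S1].
  destruct (zsum_shift (- Z.of_nat a + Z.of_nat b) _
    (ex_Emu (r + 1) _ (cubic_shift (INR a - INR b) f F))) as [X2 S2].
  rewrite <- S1, <- S2, <- !zsum_scal, <- zsum_plus by now apply ex_zsum_scal.
  apply zsum_ext. intros d. rewrite mu_rec by assumption.
  replace (d - Z.of_nat a)%Z with (d + - Z.of_nat a)%Z by lia.
  replace (d + - Z.of_nat a + Z.of_nat b)%Z with (d + (- Z.of_nat a + Z.of_nat b))%Z by lia.
  replace (IZR (d + - Z.of_nat a) + INR a) with (IZR d).
  replace (IZR (d + (- Z.of_nat a + Z.of_nat b)) + (INR a - INR b)) with (IZR d).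
  ring.
  all: rewrite !plus_IZR, ?opp_IZR, ?INR_IZR_INZ; ring.
Qed.

End Expectation.

(** * Variance and the Stein functional of mu *)

Lemma cubic_poly (A B C D : R) (f : R -> R) :
  (forall x, Rabs (f x) <= A + B * Rabs x + C * Rabs x ^ 2 + D * Rabs x ^ 3) -> cubic f.
Proof.
  intros H.
  apply cubic_le with (fun x => A + B * Rabs x + C * Rabs x ^ 2 + D * Rabs x ^ 3).
  { intros x. eapply Rle_trans; [apply H|apply Rle_abs]. }
  repeat apply cubic_plus; [apply cubic_const| | |]; apply cubic_scal.
  - apply cubic_abs, cubic_id.
  - apply cubic_ext with (fun x => Rabs (x ^ 2)); [intros; now rewrite <- RPow_abs|].
    apply cubic_abs, cubic_pow; lia.
  - apply cubic_ext with (fun x => Rabs (x ^ 3)); [intros; now rewrite <- RPow_abs|].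
    apply cubic_abs, cubic_pow; lia.
Qed.

(* [f1] plays the role of [f'], and [M] of a bound on [f''] (up to a factor). *)
Definition taylor2 (M : R) (f f1 : R -> R) : Prop :=
  (forall x y, Rabs (f (x + y) - f x - y * f1 x) <= M * y ^ 2) /\
  (forall x y, Rabs (f1 (x + y) - f1 x) <= M * Rabs y).

Definition lipschitz (L : R) (f : R -> R) : Prop :=
  forall x y, Rabs (f (x + y) - f x) <= L * Rabs y.

Lemma lipschitz_nonneg (L : R) (f : R -> R) : lipschitz L f -> 0 <= L.
Proof.
  intros H. specialize (H 0 1). rewrite Rabs_R1 in H.
  pose proof (Rabs_pos (f (0 + 1) - f 0)). lra.
Qed.

Lemma lipschitz_cubic (L : R) (f : R -> R) : lipschitz L f -> cubic f.
Proof.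
  intros H. apply (cubic_poly (Rabs (f 0)) L 0 0). intros x.
  specialize (H 0 x). rewrite Rplus_0_l in H.
  replace (f x) with ((f x - f 0) + f 0) by ring.
  pose proof (Rabs_triang (f x - f 0) (f 0)). lra.
Qed.

Lemma taylor2_shift (M c : R) (f f1 : R -> R) :
  taylor2 M f f1 -> taylor2 M (fun x => f (x + c)) (fun x => f1 (x + c)).
Proof.
  intros [H H']. split; intros x y; replace (x + y + c) with (x + c + y) by ring; auto.
Qed.

Lemma taylor2_growth (M : R) (f f1 : R -> R) (x : R) :
  taylor2 M f f1 -> Rabs (f x) <= Rabs (f 0) + Rabs (f1 0) * Rabs x + M * Rabs x ^ 2.
Proof.
  intros [H _]. specialize (H 0 x). rewrite Rplus_0_l in H.
  rewrite pow2_abs.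
  replace (f x) with ((f x - f 0 - x * f1 0) + f 0 + f1 0 * x) by ring.
  pose proof (Rabs_triang (f x - f 0 - x * f1 0 + f 0) (f1 0 * x)).
  pose proof (Rabs_triang (f x - f 0 - x * f1 0) (f 0)).
  rewrite Rabs_mult in H0. lra.
Qed.

Lemma taylor2_cubic (M : R) (f f1 : R -> R) : taylor2 M f f1 -> cubic f.
Proof.
  intros H. apply (cubic_poly (Rabs (f 0)) (Rabs (f1 0)) M 0). intros x.
  pose proof (taylor2_growth M f f1 x H). lra.
Qed.

Lemma taylor2_cubic_mul (M : R) (f f1 : R -> R) :
  taylor2 M f f1 -> cubic (fun x => x * f x).
Proof.
  intros H. apply (cubic_poly 0 (Rabs (f 0)) (Rabs (f1 0)) M). intros x.
  pose proof (taylor2_growth M f f1 x H). rewrite Rabs_mult.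
  pose proof (Rabs_pos x). nra.
Qed.

Lemma Rabs_between (x A : R) : Rabs x <= A -> - A <= x <= A.
Proof. apply Rabs_le_between. Qed.

Section Moments.
Variable b : nat.
Hypothesis hb : (2 <= b)%nat.
Let B := INR b.
Let b_pos : 2 <= B.
Proof. apply (le_INR 2); assumption. Qed.

Local Notation E := (Emu b).

(** A fixed-point equation for the law of [r = 1]. On [1], [x] and [x ^ 2] it becomes a linear
    equation for the unknown moment, with the nonzero coefficient [B - 1]. *)
Lemma Emu_1_rec (f : R -> R) : cubic f ->
  E 1 f = (B - 1) / B * f 1 + 1 / B * E 1 (fun x => f (x + (1 - B))).
Proof.
  intros F. pose proof (Emu_rec b hb 0 1 f ltac:(lia) F) as H.
  replace (b * 0 + 1)%nat with 1%nat in H by lia.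
  rewrite H, Emu_0 by assumption. simpl (INR 1). simpl (0 + 1)%nat. fold B.
  rewrite Rplus_0_l. reflexivity.
Qed.

Lemma Emu_one (r : nat) : E r (fun _ => 1) = 1.
Proof.
  revert r. apply (base_ind b hb (fun r => E r (fun _ => 1) = 1)).
  - now rewrite Emu_0.
  - pose proof (Emu_1_rec _ (cubic_const 1)) as H. set (e := E 1 (fun _ => 1)) in *.
    assert (e * B = B - 1 + e) by (rewrite H at 1; field; lra).
    assert ((e - 1) * (B - 1) = 0) by lra. nra.
  - intros r a Ha _ I1 I2. rewrite Emu_rec by (auto using cubic_const; lia). rewrite I1.
    fold B. destruct I2 as [->|I2]; [simpl; field; lra|]. rewrite I2. field. lra.
Qed.

Lemma Emu_const (r : nat) (c : R) : E r (fun _ => c) = c.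
Proof.
  rewrite (Emu_ext b r _ (fun _ => c * 1)) by (intros; ring).
  rewrite Emu_scal, Emu_one. ring.
Qed.

Lemma Emu_add_const (r : nat) (c : R) (f : R -> R) : cubic f ->
  E r (fun x => f x + c) = E r f + c.
Proof. intros F. rewrite Emu_plus; auto using cubic_const. now rewrite Emu_const. Qed.

(** The two shifts balance: [(B - a) / B * a + a / B * (a - B) = 0]. *)
Lemma Emu_id (r : nat) : E r (fun x => x) = 0.
Proof.
  revert r. apply (base_ind b hb (fun r => E r (fun x => x) = 0)).
  - now rewrite Emu_0.
  - pose proof (Emu_1_rec _ cubic_id) as H. cbv beta in H.
    rewrite (Emu_add_const 1 (1 - B) _ cubic_id) in H.
    set (e := E 1 (fun x => x)) in *.
    assert (e * B = e) by (rewrite H at 1; field; lra). nra.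
  - intros r a Ha _ I1 I2. rewrite Emu_rec by (auto using cubic_id; lia).
    rewrite !Emu_add_const, I1 by apply cubic_id. fold B.
    destruct I2 as [->|I2]; [simpl; field; lra|]. rewrite I2. field. lra.
Qed.

Definition Vmu (r : nat) : R := E r (fun x => x ^ 2).

Lemma cubic_sq : cubic (fun x => x ^ 2).
Proof. apply cubic_pow. lia. Qed.

Lemma Emu_sq_shift (r : nat) (c : R) : E r (fun x => (x + c) ^ 2) = Vmu r + c ^ 2.
Proof.
  rewrite (Emu_ext b r _ (fun x => (x ^ 2 + (2 * c) * x) + c ^ 2)) by (intros; ring).
  rewrite Emu_add_const, Emu_plus, Emu_scal, Emu_id; try apply cubic_plus;
    auto using cubic_sq, cubic_scal, cubic_id. unfold Vmu. ring.
Qed.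

Lemma Vmu_0 : Vmu 0 = 0.
Proof. unfold Vmu. rewrite Emu_0 by assumption. ring. Qed.

Lemma Vmu_1 : Vmu 1 = B.
Proof.
  unfold Vmu. pose proof (Emu_1_rec _ cubic_sq) as H. cbv beta in H.
  rewrite Emu_sq_shift in H. fold (Vmu 1) in *. set (v := Vmu 1) in *.
  assert (v * B = B - 1 + v + (1 - B) ^ 2) by (rewrite H at 1; field; lra).
  assert ((v - B) * (B - 1) = 0) by nra. nra.
Qed.

Lemma Vmu_rec (r a : nat) : (a <= b)%nat ->
  Vmu (b * r + a) = (B - INR a) / B * Vmu r + INR a / B * Vmu (r + 1) + INR a * (B - INR a).
Proof.
  intros Ha. unfold Vmu at 1. rewrite Emu_rec, !Emu_sq_shift by auto using cubic_sq.
  fold B. field. lra.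
Qed.

Lemma Vmu_nonneg (r : nat) : 0 <= Vmu r.
Proof.
  unfold Vmu. rewrite <- (Emu_const r 0). apply Emu_le; auto using cubic_const, cubic_sq.
  intros; nra.
Qed.

Lemma Vmu_diff_rec (r a : nat) : (a < b)%nat ->
  Vmu (b * r + a + 1) - Vmu (b * r + a) = (B - 2 * INR a - 1) + (Vmu (r + 1) - Vmu r) / B.
Proof.
  intros Ha. rewrite <- Nat.add_assoc, !Vmu_rec by lia. rewrite plus_INR. simpl (INR 1).
  field. lra.
Qed.

(** The difference recursion contracts by [1 / B], and its source satisfies
    [|B - 2 a - 1| <= B - 1], so the bound [B] reproduces itself. It is attained at [r = 0]. *)
Lemma Vmu_diff (r : nat) : Rabs (Vmu (r + 1) - Vmu r) <= B.
Proof.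
  induction r as [r IH] using (well_founded_induction lt_wf).
  destruct r as [|r].
  - simpl. rewrite Vmu_0, Vmu_1, Rabs_pos_eq; lra.
  - set (n := S r) in *.
    pose proof (Nat.div_mod_eq n b) as En.
    assert (Hm : (n mod b < b)%nat) by (apply Nat.mod_upper_bound; lia).
    set (q := (n / b)%nat) in *. set (j := (n mod b)%nat) in *.
    specialize (IH q ltac:(unfold n in *; nia)).
    rewrite En, Vmu_diff_rec by assumption.
    apply Rabs_between in IH. apply Rabs_le.
    assert (0 <= INR j <= B - 1).
    { split; [apply pos_INR|]. assert (INR (j + 1) <= B) by (apply le_INR; lia).
      rewrite plus_INR in H; simpl in H; lra. }
    assert (-1 <= (Vmu (q + 1) - Vmu q) / B <= 1); [|lra].
    split; [apply Rle_div_r|apply Rle_div_l]; lra.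
Qed.

Lemma Emu_1_abs_le : E 1 Rabs <= (B + 1) / 2.
Proof.
  apply Rle_trans with (E 1 (fun x => / 2 * x ^ 2 + / 2)).
  - apply Emu_le; auto.
    + apply cubic_abs, cubic_id.
    + apply cubic_plus; [apply cubic_scal, cubic_sq|apply cubic_const].
    + intros x. rewrite <- (pow2_abs x). pose proof (pow2_ge_0 (Rabs x - 1)). nra.
  - rewrite Emu_add_const, Emu_scal by apply cubic_scal, cubic_sq.
    fold (Vmu 1). rewrite Vmu_1. lra.
Qed.

Lemma Emu_shift_lipschitz (r : nat) (L c : R) (g : R -> R) : lipschitz L g ->
  Rabs (E r (fun x => g (x + c)) - E r g) <= L * Rabs c.
Proof.
  intros H. pose proof (lipschitz_cubic L g H) as G.
  rewrite <- Emu_minus by auto using cubic_shift.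
  eapply Rle_trans; [apply Emu_abs_le with (g := fun _ => L * Rabs c)|]; auto using cubic_const.
  - apply cubic_minus; auto using cubic_shift.
  - rewrite Emu_const; lra.
Qed.

Lemma Emu_shift_taylor2 (r : nat) (M c : R) (f f1 : R -> R) : taylor2 M f f1 ->
  Rabs (E r (fun x => f (x + c)) - E r f - c * E r f1) <= M * c ^ 2.
Proof.
  intros H. pose proof (taylor2_cubic M f f1 H) as F.
  pose proof (lipschitz_cubic M f1 (proj2 H)) as F1.
  rewrite <- Emu_scal, <- !Emu_minus; auto using cubic_shift, cubic_minus, cubic_scal.
  eapply Rle_trans; [apply Emu_abs_le with (g := fun _ => M * c ^ 2)|]; auto using cubic_const.
  - apply cubic_minus; auto using cubic_shift, cubic_scal, cubic_minus.
  - intros x. apply (proj1 H).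
  - rewrite Emu_const; lra.
Qed.

(** With a common quotient [q], the weights for [r + 1] and [r] differ by [1 / B]. The difference is
    thus [(E (q + 1) g - E q g) / B] plus shift errors of total size at most [2 L B]; the constant 8
    leaves ample room. *)
Lemma Emu_succ_lipschitz (r : nat) : forall (L : R) (g : R -> R), lipschitz L g ->
  Rabs (E (r + 1) g - E r g) <= 8 * B * L.
Proof.
  induction r as [r IH] using (well_founded_induction lt_wf). intros L g H.
  pose proof (lipschitz_cubic L g H) as G. pose proof (lipschitz_nonneg L g H) as HL.
  destruct r as [|r].
  - simpl (0 + 1)%nat. rewrite Emu_0 by assumption. rewrite <- (Emu_const 1 (g 0)).
    rewrite <- Emu_minus by auto using cubic_const.
    apply Rle_trans with (E 1 (fun x => L * Rabs x)).
    + apply Emu_abs_le; auto using cubic_minus, cubic_const.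
      * apply cubic_scal, cubic_abs, cubic_id.
      * intros x. specialize (H 0 x). now rewrite Rplus_0_l in H.
    + rewrite Emu_scal. pose proof Emu_1_abs_le. nra.
  - set (n := S r) in *.
    pose proof (Nat.div_mod_eq n b) as En.
    assert (Hm : (n mod b < b)%nat) by (apply Nat.mod_upper_bound; lia).
    set (q := (n / b)%nat) in *. set (j := (n mod b)%nat) in *.
    specialize (IH q ltac:(unfold n in *; nia) L g H).
    rewrite En, <- Nat.add_assoc, !Emu_rec by (auto; lia).
    rewrite plus_INR. simpl (INR 1). fold B.
    assert (Hj : 0 <= INR j <= B - 1).
    { split; [apply pos_INR|]. assert (Hj : INR (j + 1) <= B) by (apply le_INR; lia).
      rewrite plus_INR in Hj; simpl in Hj; lra. }
    set (a := INR j) in *.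
    assert (S1 : Rabs (E q (fun x => g (x + (a + 1))) - E q g) <= L * B).
    { eapply Rle_trans; [now apply Emu_shift_lipschitz|]. rewrite Rabs_pos_eq; nra. }
    assert (S2 : Rabs (E q (fun x => g (x + a)) - E q g) <= L * B).
    { eapply Rle_trans; [now apply Emu_shift_lipschitz|]. rewrite Rabs_pos_eq; nra. }
    assert (S3 : Rabs (E (q + 1) (fun x => g (x + (a + 1 - B))) - E (q + 1) g) <= L * B).
    { eapply Rle_trans; [now apply Emu_shift_lipschitz|]. rewrite Rabs_left1; nra. }
    assert (S4 : Rabs (E (q + 1) (fun x => g (x + (a - B))) - E (q + 1) g) <= L * B).
    { eapply Rle_trans; [now apply Emu_shift_lipschitz|]. rewrite Rabs_left1; nra. }
    set (x1 := E q (fun x => g (x + (a + 1)))) in *. set (x2 := E q (fun x => g (x + a))) in *.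
    set (x3 := E (q + 1) (fun x => g (x + (a + 1 - B)))) in *.
    set (x4 := E (q + 1) (fun x => g (x + (a - B)))) in *.
    set (e1 := E q g) in *. set (e2 := E (q + 1) g) in *.
    replace ((B - (a + 1)) / B * x1 + (a + 1) / B * x3 - ((B - a) / B * x2 + a / B * x4))
      with (((B - (a + 1)) * (x1 - e1) + (a + 1) * (x3 - e2) - (B - a) * (x2 - e1)
              - a * (x4 - e2) + (e2 - e1)) / B) by (field; lra).
    apply Rabs_between in S1, S2, S3, S4, IH.
    apply Rabs_le. split; [apply Rle_div_r|apply Rle_div_l]; try lra.
    + assert (- (B - (a + 1)) * (L * B) <= (B - (a + 1)) * (x1 - e1)) by nra.
      assert (- (a + 1) * (L * B) <= (a + 1) * (x3 - e2)) by nra.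
      assert ((B - a) * (x2 - e1) <= (B - a) * (L * B)) by nra.
      assert (a * (x4 - e2) <= a * (L * B)) by nra.
      assert (0 <= L * B * (B - 2)) by (apply Rmult_le_pos; nra).
      nra.
    + assert ((B - (a + 1)) * (x1 - e1) <= (B - (a + 1)) * (L * B)) by nra.
      assert ((a + 1) * (x3 - e2) <= (a + 1) * (L * B)) by nra.
      assert (- (B - a) * (L * B) <= (B - a) * (x2 - e1)) by nra.
      assert (- a * (L * B) <= a * (x4 - e2)) by nra.
      assert (0 <= L * B * (B - 2)) by (apply Rmult_le_pos; nra).
      nra.
Qed.

(** Expanding the four shifts to first order leaves only the combination [(B - 2 a - 1) * (g2 - g1)]
    of the expectations of [f1], and [Emu_succ_lipschitz] bounds it through [M] alone. In the
    induction step, the second-order terms, this combination and the inherited difference contribute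
    at most [2], [4] and [10] times [B ^ 3 M] before the division by [B]. *)
Lemma Emu_succ_taylor2 (r : nat) : forall (M : R) (f f1 : R -> R), taylor2 M f f1 ->
  Rabs (E (r + 1) f - E r f) <= 20 * B ^ 2 * M.
Proof.
  induction r as [r IH] using (well_founded_induction lt_wf). intros M f f1 H.
  pose proof (taylor2_cubic M f f1 H) as F. pose proof (lipschitz_nonneg M f1 (proj2 H)) as HM.
  destruct r as [|r].
  - simpl (0 + 1)%nat. rewrite Emu_0 by assumption.
    (* The affine part of [f] at 0 has expectation [f 0] because the law has mean zero. *)
    replace (E 1 f - f 0) with (E 1 (fun x => f x - (f1 0 * x + f 0))).
    2: { rewrite Emu_minus, Emu_add_const, Emu_scal, Emu_id; try ring;
         auto using cubic_scal, cubic_id, cubic_plus, cubic_const. }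
    apply Rle_trans with (E 1 (fun x => M * x ^ 2)).
    + apply Emu_abs_le; auto using cubic_scal, cubic_sq.
      * apply cubic_minus; auto using cubic_scal, cubic_id, cubic_plus, cubic_const.
      * intros x. pose proof (proj1 H 0 x) as Hx. rewrite Rplus_0_l in Hx.
        replace (f x - (f1 0 * x + f 0)) with (f x - f 0 - x * f1 0) by ring. exact Hx.
    + rewrite Emu_scal. fold (Vmu 1). rewrite Vmu_1.
      assert (0 <= M * B * (B - 2)) by (repeat apply Rmult_le_pos; lra). nra.
  - set (n := S r) in *.
    pose proof (Nat.div_mod_eq n b) as En.
    assert (Hm : (n mod b < b)%nat) by (apply Nat.mod_upper_bound; lia).
    set (q := (n / b)%nat) in *. set (j := (n mod b)%nat) in *.
    specialize (IH q ltac:(unfold n in *; nia) M f f1 H).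
    pose proof (Emu_succ_lipschitz q M f1 (proj2 H)) as IL.
    rewrite En, <- Nat.add_assoc, !Emu_rec by (auto; lia).
    rewrite plus_INR. simpl (INR 1). fold B.
    assert (Hj : 0 <= INR j <= B - 1).
    { split; [apply pos_INR|]. assert (Hj : INR (j + 1) <= B) by (apply le_INR; lia).
      rewrite plus_INR in Hj; simpl in Hj; lra. }
    set (a := INR j) in *.
    assert (Hs : forall s c, - B <= c <= B ->
      Rabs (E s (fun x => f (x + c)) - E s f - c * E s f1) <= M * B ^ 2).
    { intros s c Hc. eapply Rle_trans; [now apply (Emu_shift_taylor2 s M c f f1)|].
      apply Rmult_le_compat_l; [assumption|nra]. }
    pose proof (Hs q (a + 1) ltac:(lra)) as S1. pose proof (Hs q a ltac:(lra)) as S2.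
    pose proof (Hs (q + 1)%nat (a + 1 - B) ltac:(lra)) as S3.
    pose proof (Hs (q + 1)%nat (a - B) ltac:(lra)) as S4.
    set (x1 := E q (fun x => f (x + (a + 1)))) in *. set (x2 := E q (fun x => f (x + a))) in *.
    set (x3 := E (q + 1) (fun x => f (x + (a + 1 - B)))) in *.
    set (x4 := E (q + 1) (fun x => f (x + (a - B)))) in *.
    set (e1 := E q f) in *. set (e2 := E (q + 1) f) in *.
    set (g1 := E q f1) in *. set (g2 := E (q + 1) f1) in *.
    replace ((B - (a + 1)) / B * x1 + (a + 1) / B * x3 - ((B - a) / B * x2 + a / B * x4))
      with (((B - (a + 1)) * (x1 - e1 - (a + 1) * g1)
             + (a + 1) * (x3 - e2 - (a + 1 - B) * g2)
             - (B - a) * (x2 - e1 - a * g1)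
             - a * (x4 - e2 - (a - B) * g2)
             + (e2 - e1) - (B - 2 * a - 1) * (g2 - g1)) / B) by (field; lra).
    apply Rabs_between in S1, S2, S3, S4, IH, IL.
    set (y1 := x1 - e1 - (a + 1) * g1) in *. set (y2 := x2 - e1 - a * g1) in *.
    set (y3 := x3 - e2 - (a + 1 - B) * g2) in *. set (y4 := x4 - e2 - (a - B) * g2) in *.
    set (u := g2 - g1) in *. set (v := e2 - e1) in *.
    assert (Hu : - (B * (8 * B * M)) <= (B - 2 * a - 1) * u <= B * (8 * B * M)).
    { assert (0 <= 8 * B * M) by nra. apply Rabs_between. rewrite Rabs_mult.
      apply Rmult_le_compat; try apply Rabs_pos; apply Rabs_le; lra. }
    assert (K1 : 20 * B ^ 2 * M <= 10 * B ^ 3 * M).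
    { assert (0 <= B ^ 2 * M * (B - 2)) by (apply Rmult_le_pos; nra). nra. }
    assert (K2 : B * (8 * B * M) <= 4 * B ^ 3 * M).
    { assert (0 <= B ^ 2 * M * (B - 2)) by (apply Rmult_le_pos; nra). nra. }
    assert (K0 : 0 <= B ^ 3 * M) by (apply Rmult_le_pos; [apply pow_le|]; lra).
    apply Rabs_le. split; [apply Rle_div_r|apply Rle_div_l]; try lra.
    + assert (- (B - (a + 1)) * (M * B ^ 2) <= (B - (a + 1)) * y1) by nra.
      assert (- (a + 1) * (M * B ^ 2) <= (a + 1) * y3) by nra.
      assert ((B - a) * y2 <= (B - a) * (M * B ^ 2)) by nra.
      assert (a * y4 <= a * (M * B ^ 2)) by nra.
      nra.
    + assert ((B - (a + 1)) * y1 <= (B - (a + 1)) * (M * B ^ 2)) by nra.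
      assert ((a + 1) * y3 <= (a + 1) * (M * B ^ 2)) by nra.
      assert (- (B - a) * (M * B ^ 2) <= (B - a) * y2) by nra.
      assert (- a * (M * B ^ 2) <= a * y4) by nra.
      nra.
Qed.

(** The digit step requires [50 * B]. The third absolute moment comes from [r = 1], where [f] is
    expanded at 0 and [x f] has a remainder of size [M |x| ^ 3]. *)
Definition stein_const : R := 50 * B + E 1 (fun x => Rabs x ^ 3).

Lemma cubic_abs_cube : cubic (fun x => Rabs x ^ 3).
Proof.
  apply cubic_ext with (fun x => Rabs (x ^ 3)); [intros; now rewrite <- RPow_abs|].
  apply cubic_abs, cubic_pow; lia.
Qed.

Lemma Emu_1_cube_nonneg : 0 <= E 1 (fun x => Rabs x ^ 3).
Proof.
  rewrite <- (Emu_const 1 0). apply Emu_le; auto using cubic_const, cubic_abs_cube.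
  intros; apply pow_le, Rabs_pos.
Qed.

(* With [t = a (B - a) / B], every first-order contribution cancels because the
   variance recursion matches; what is left carries the factor [t]. *)
Lemma stein_step_algebra (a V1 V2 M C A F x1 x2 y1 y2 s1 s2 : R) :
  0 <= a <= B -> 0 <= M -> 50 * B <= C -> Rabs (V2 - V1) <= B ->
  Rabs (V1 * x1 - s1) <= C * M * V1 -> Rabs (V2 * x2 - s2) <= C * M * V2 ->
  Rabs (x1 - A) <= M * B -> Rabs (x2 - A) <= M * (9 * B) ->
  Rabs (y1 - F - a * A) <= M * B ^ 2 ->
  Rabs (y2 - F - (a - B) * A) <= M * (29 * B ^ 2) ->
  let V := (B - a) / B * V1 + a / B * V2 + a * (B - a) in
  Rabs (V * ((B - a) / B * x1 + a / B * x2)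
        - ((B - a) / B * (s1 + a * y1) + a / B * (s2 + (a - B) * y2))) <= C * M * V.
Proof.
  intros Ha HM HC HV H1 H2 X1 X2 Y1 Y2 V.
  set (t := a * (B - a) / B).
  assert (Ht : 0 <= t) by (apply Rdiv_le_0_compat; nra).
  assert (Ep : 0 <= (B - a) / B) by (apply Rdiv_le_0_compat; lra).
  assert (Eq : 0 <= a / B) by (apply Rdiv_le_0_compat; lra).
  set (dv := (V2 - V1) / B).
  assert (Hd : -1 <= dv <= 1).
  { apply Rabs_between in HV. unfold dv.
    split; [apply Rle_div_r|apply Rle_div_l]; lra. }
  (* Here [V - V1 = a * (dv + B - a)] and [V - V2 = (B - a) * (a - dv)], so both acquire the factor
     [t] after weighting. The coefficients of [x1] and [x2] then add up to [B], and [y1 - y2]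
     contributes [B * A] with the opposite sign. *)
  replace (V * ((B - a) / B * x1 + a / B * x2)
        - ((B - a) / B * (s1 + a * y1) + a / B * (s2 + (a - B) * y2)))
    with ((B - a) / B * (V1 * x1 - s1) + a / B * (V2 * x2 - s2)
          + t * ((dv + (B - a)) * (x1 - A) + (a - dv) * (x2 - A)
                 - (y1 - F - a * A) + (y2 - F - (a - B) * A)))
    by (unfold V, t, dv; field; lra).
  set (w1 := V1 * x1 - s1) in *. set (w2 := V2 * x2 - s2) in *.
  set (u1 := x1 - A) in *. set (u2 := x2 - A) in *.
  set (v1 := y1 - F - a * A) in *. set (v2 := y2 - F - (a - B) * A) in *.
  assert (P1 : Rabs ((B - a) / B * w1) <= (B - a) / B * (C * M * V1)).
  { rewrite Rabs_mult, (Rabs_pos_eq _ Ep). now apply Rmult_le_compat_l. }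
  assert (P2 : Rabs (a / B * w2) <= a / B * (C * M * V2)).
  { rewrite Rabs_mult, (Rabs_pos_eq _ Eq). now apply Rmult_le_compat_l. }
  assert (Q1 : Rabs ((dv + (B - a)) * u1) <= (1 + B) * (M * B)).
  { rewrite Rabs_mult. apply Rmult_le_compat; try apply Rabs_pos; auto.
    apply Rabs_le; lra. }
  assert (Q2 : Rabs ((a - dv) * u2) <= (1 + B) * (M * (9 * B))).
  { rewrite Rabs_mult. apply Rmult_le_compat; try apply Rabs_pos; auto.
    apply Rabs_le; lra. }
  assert (P3 : Rabs (t * ((dv + (B - a)) * u1 + (a - dv) * u2 - v1 + v2)) <= t * (M * (C * B))).
  { rewrite Rabs_mult, (Rabs_pos_eq _ Ht). apply Rmult_le_compat_l; [assumption|].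
    apply Rabs_between in Q1, Q2, Y1, Y2.
    (* The left side is [M * (10 * B + 40 * B ^ 2)], at most [M * 50 * B ^ 2]; this is the origin of
       the 50. *)
    assert (W : (1 + B) * (M * B) + (1 + B) * (M * (9 * B)) + M * B ^ 2 + M * (29 * B ^ 2)
            <= M * (C * B)).
    { assert (0 <= M * B * (C - 50 * B)) by (apply Rmult_le_pos; nra).
      assert (0 <= M * B * (B - 1)) by (apply Rmult_le_pos; nra). nra. }
    apply Rabs_le. lra. }
  (* The source term [a * (B - a)] of the variance equals [t * B] and pays for the remainder. *)
  assert (Et : C * M * V = (B - a) / B * (C * M * V1) + a / B * (C * M * V2) + t * (M * (C * B)))
    by (unfold V, t; field; lra).
  rewrite Et. apply Rabs_between in P1, P2, P3. apply Rabs_le. lra.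
Qed.

(** The statement quantifies over [f] after [r] because the induction hypotheses are applied to the
    translates of [f] by [a] and [a - B]. A translate of [x f] differs from [x] times the translate
    of [f] by a multiple of that translate, and these extra terms supply the gain in variance. *)
Lemma Emu_stein (r : nat) : forall (M : R) (f f1 : R -> R), taylor2 M f f1 ->
  Rabs (Vmu r * E r f1 - E r (fun x => x * f x)) <= stein_const * M * Vmu r.
Proof.
  revert r. apply (base_ind b hb (fun r => forall (M : R) (f f1 : R -> R), taylor2 M f f1 ->
    Rabs (Vmu r * E r f1 - E r (fun x => x * f x)) <= stein_const * M * Vmu r)).
  - intros M f f1 H. rewrite Vmu_0, Emu_0, Emu_0 by assumption.
    rewrite !Rmult_0_l, Rmult_0_r, Rminus_0_r, Rabs_R0. lra.
  - intros M f f1 H. rewrite Vmu_1.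
    pose proof (taylor2_cubic_mul M f f1 H) as F.
    pose proof (lipschitz_nonneg M f1 (proj2 H)) as HM.
    pose proof (Emu_succ_lipschitz 0 M f1 (proj2 H)) as IL.
    simpl (0 + 1)%nat in IL. rewrite Emu_0 in IL by assumption.
    assert (S : Rabs (E 1 (fun x => x * f x) - B * f1 0) <= M * E 1 (fun x => Rabs x ^ 3)).
    { replace (E 1 (fun x => x * f x) - B * f1 0)
        with (E 1 (fun x => x * f x - (f1 0 * x ^ 2 + f 0 * x))).
      2: { rewrite Emu_minus, Emu_plus, !Emu_scal, Emu_id;
           auto using cubic_plus, cubic_scal, cubic_sq, cubic_id.
           fold (Vmu 1). rewrite Vmu_1. ring. }
      rewrite <- Emu_scal. apply Emu_abs_le; auto using cubic_scal, cubic_abs_cube.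
      - apply cubic_minus; auto using cubic_plus, cubic_scal, cubic_sq, cubic_id.
      - intros x. pose proof (proj1 H 0 x) as Hx. rewrite Rplus_0_l in Hx.
        replace (x * f x - (f1 0 * x ^ 2 + f 0 * x)) with (x * (f x - f 0 - x * f1 0)) by ring.
        rewrite Rabs_mult. pose proof (Rabs_pos x).
        rewrite <- pow2_abs in Hx. nra. }
    unfold stein_const. pose proof Emu_1_cube_nonneg as K0.
    set (K := E 1 (fun x => Rabs x ^ 3)) in *.
    apply Rabs_between in S, IL. apply Rabs_le.
    assert (0 <= M * K * (B - 1)) by (repeat apply Rmult_le_pos; lra).
    assert (- (8 * B * M * B) <= B * (E 1 f1 - f1 0) <= 8 * B * M * B) by nra.
    assert (0 <= M * B ^ 2) by nra.
    nra.
  - intros r j Hj _ I1 I2 M f f1 H.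
    pose proof (taylor2_cubic_mul M f f1 H) as F.
    pose proof (taylor2_cubic M f f1 H) as F0.
    pose proof (lipschitz_cubic M f1 (proj2 H)) as F1.
    pose proof (lipschitz_nonneg M f1 (proj2 H)) as HM.
    rewrite Vmu_rec, !Emu_rec by (auto; lia). fold B.
    assert (Ha : 0 <= INR j <= B) by (split; [apply pos_INR|apply le_INR; lia]).
    set (a := INR j) in *.
    assert (X : forall s c, E s (fun x => (x + c) * f (x + c))
      = E s (fun x => x * f (x + c)) + c * E s (fun x => f (x + c))).
    { intros s c. rewrite <- Emu_scal, <- Emu_plus; auto using cubic_scal, cubic_shift.
      apply Emu_ext; intros; ring.
      apply (taylor2_cubic_mul M _ _ (taylor2_shift M c f f1 H)). }
    rewrite !X.
    assert (HC : 50 * B <= stein_const)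
      by (unfold stein_const; pose proof Emu_1_cube_nonneg; lra).
    assert (I2' : a = 0 \/ Rabs (Vmu (r + 1) * E (r + 1) (fun x => f1 (x + (a - B)))
      - E (r + 1) (fun x => x * f (x + (a - B)))) <= stein_const * M * Vmu (r + 1)).
    { destruct I2 as [I2|I2]; [left; unfold a; now rewrite I2|right].
      apply (I2 M _ _ (taylor2_shift M (a - B) f f1 H)). }
    specialize (I1 M _ _ (taylor2_shift M a f f1 H)).
    destruct I2' as [Ea|I2'].
    + rewrite Ea in *. unfold Rdiv. rewrite !Rminus_0_r, !Rmult_0_l, !Rplus_0_r.
      rewrite !Rinv_r, !Rmult_1_l by lra. exact I1.
    + pose proof (Emu_succ_lipschitz r M f1 (proj2 H)) as L1.
      pose proof (Emu_succ_taylor2 r M f f1 H) as L2.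
      pose proof (Emu_shift_lipschitz r M a f1 (proj2 H)) as T1.
      pose proof (Emu_shift_lipschitz (r + 1) M (a - B) f1 (proj2 H)) as T2.
      pose proof (Emu_shift_taylor2 r M a f f1 H) as T3.
      pose proof (Emu_shift_taylor2 (r + 1) M (a - B) f f1 H) as T4.
      rewrite (Rabs_pos_eq a) in T1 by lra. rewrite (Rabs_left1 (a - B)) in T2 by lra.
      (* The reference values belong to [r]. Passing from [r + 1] to [r] costs [8 B M] for [f1] and
         [20 B ^ 2 M] for [f]; with the shift errors this gives [9 = 8 + 1] and
         [29 = 20 + 8 + 1]. *)
      apply (stein_step_algebra a (Vmu r) (Vmu (r + 1)) M stein_const (E r f1) (E r f));
        auto using Vmu_diff.
      * nra.
      * apply Rabs_between in L1, T2. apply Rabs_le. nra.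
      * eapply Rle_trans; [exact T3|]. apply Rmult_le_compat_l; nra.
      * apply Rabs_between in L1, L2, T4. apply Rabs_le.
        set (g1 := E r f1) in *. set (g2 := E (r + 1) f1) in *.
        set (e1 := E r f) in *. set (e2 := E (r + 1) f) in *.
        set (y := E (r + 1) (fun x => f (x + (a - B)))) in *.
        assert (G : - (B * (8 * B * M)) <= (a - B) * (g2 - g1) <= B * (8 * B * M)).
        { apply Rabs_between. rewrite Rabs_mult.
          apply Rmult_le_compat; try apply Rabs_pos; apply Rabs_le; lra. }
        assert (Q : M * (a - B) ^ 2 <= M * B ^ 2) by (apply Rmult_le_compat_l; nra).
        lra.
Qed.

(** * The variance dominates the number of blocks *)

Lemma rho_rec (q a y : nat) (l : list nat) : (a < b)%nat -> (1 <= q)%nat ->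
  digits b q = y :: l ->
  rho b (b * q + a) = ((if new_block b (Some a) y then 1 else 0) + rho b q)%nat.
Proof.
  intros Ha Hq El. unfold rho. rewrite digits_rec by nia. rewrite El. simpl. lia.
Qed.

Definition low_nonzero (r : nat) : R := if Nat.eqb (r mod b) 0 then 0 else 1.

(* Appending a zero digit leaves the variance unchanged; a nonzero digit that opens a
   block raises it by at least [1]. The extra term pays in advance for a block of zeros. *)
Lemma rho_le_Vmu_aux (r : nat) : (1 <= r)%nat ->
  INR (rho b r) + low_nonzero r <= 2 * Vmu r.
Proof.
  induction r as [r IH] using (well_founded_induction lt_wf). intros Hr.
  unfold low_nonzero.
  pose proof (Nat.div_mod_eq r b) as En.
  assert (Hm : (r mod b < b)%nat) by (apply Nat.mod_upper_bound; lia).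
  set (q := (r / b)%nat) in *. set (a := (r mod b)%nat) in *.
  assert (Ha1 : INR a <= B - 1).
  { assert (H : INR (a + 1) <= B) by (apply le_INR; lia).
    rewrite plus_INR in H; simpl in H; lra. }
  rewrite En, Vmu_rec by lia.
  destruct (Nat.eq_dec q 0) as [Eq|Hq].
  - rewrite Eq in *. unfold rho. rewrite digits_rec by lia.
    change (digits b 0) with (@nil nat). simpl (INR (nblocks _ _ _)).
    rewrite Vmu_0. simpl (0 + 1)%nat. rewrite Vmu_1.
    assert (1 <= INR a) by (apply (le_INR 1); lia).
    replace (INR a / B * B) with (INR a) by (field; lra).
    destruct (Nat.eqb a 0); nra.
  - pose proof (Nat.div_mod_eq q b) as Eq.
    assert (Hy : (q mod b < b)%nat) by (apply Nat.mod_upper_bound; lia).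
    specialize (IH q ltac:(nia) ltac:(lia)). unfold low_nonzero in IH.
    set (q2 := (q / b)%nat) in *. set (y := (q mod b)%nat) in *.
    rewrite (rho_rec q a y (digits b q2)); [|lia|lia|].
    2: { rewrite Eq. apply digits_rec; lia. }
    pose proof (Vmu_diff_rec q2 y Hy) as HD. rewrite <- Eq in HD.
    pose proof (Vmu_diff q2) as HD2. apply Rabs_between in HD2.
    pose proof (Vmu_diff q) as HD1. apply Rabs_between in HD1.
    assert (HD3 : -1 <= (Vmu (q2 + 1) - Vmu q2) / B) by (apply Rle_div_r; lra).
    set (D := Vmu (q + 1) - Vmu q) in *.
    (* Since [D / B >= -1], the gain is at least [a * (B - a - 1)]. This is at least 1 for a middle
       digit but can degenerate for [a = b - 1], which therefore needs the preceding digit [y]. *)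
    replace ((B - INR a) / B * Vmu q + INR a / B * Vmu (q + 1) + INR a * (B - INR a))
      with (Vmu q + INR a * (B - INR a + D / B)) by (unfold D; field; lra).
    rewrite plus_INR.
    assert (HDB : -1 <= D / B) by (apply Rle_div_r; lra).
    unfold new_block, dclass.
    destruct (Nat.eqb_spec a 0) as [A0|A0].
    + rewrite A0. destruct (Nat.eqb_spec y 0) as [Y0|Y0]; simpl.
      * lra.
      * destruct (Nat.eqb y (b - 1)); simpl; lra.
    + assert (Ha : 1 <= INR a) by (apply (le_INR 1); lia).
      destruct (Nat.eqb_spec a (b - 1)) as [A1|A1].
      * assert (Ea : INR a = B - 1) by (rewrite A1, minus_INR by lia; reflexivity).
        rewrite Ea.
        destruct (Nat.eqb_spec y (b - 1)) as [Y1|Y1].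
        (* Inside a run of digits [b - 1] a nonnegative gain suffices: no block opens, and the extra
           term is already present for [q]. *)
        -- destruct (Nat.eqb_spec y 0) as [Y0|Y0]; [lia|]. simpl. nra.
        -- assert (Hy2 : INR y <= B - 2).
           { assert (Hy2 : INR (y + 2) <= B) by (apply le_INR; lia).
             rewrite plus_INR in Hy2; simpl in Hy2; lra. }
           (* With [y <= b - 2] the difference recursion gives [D >= B - 2 y - 2 >= 2 - B], so the
              gain is at least [(B - 1) * 2 / B >= 1]. *)
           assert (HDC : -1 + 2 / B <= D / B).
           { replace (-1 + 2 / B) with ((2 - B) / B) by (field; lra).
             apply Rmult_le_compat_r; [apply Rlt_le, Rinv_0_lt_compat; lra|lra]. }
           assert (HB : 1 <= (B - 1) * (2 / B)).
           { replace ((B - 1) * (2 / B)) with ((2 * B - 2) / B) by (field; lra).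
             apply Rle_div_r; lra. }
           assert (Hf : 0 <= INR (rho b q) <= 2 * Vmu q - (if Nat.eqb y 0 then 0 else 1))
             by (split; [apply pos_INR|lra]).
           assert (1 <= (B - 1) * (B - (B - 1) + D / B)) by nra.
           destruct (Nat.eqb y 0); simpl; lra.
      * assert (Ha2 : INR a <= B - 2).
        { assert (H : INR (a + 2) <= B) by (apply le_INR; lia).
          rewrite plus_INR in H; simpl in H; lra. }
        assert (1 <= INR a * (B - INR a + D / B)) by nra.
        match goal with |- context [if ?c then 1%nat else 0%nat] => destruct c end;
        destruct (Nat.eqb y 0); simpl; lra.
Qed.

Lemma rho_le_Vmu (r : nat) : (1 <= r)%nat -> INR (rho b r) <= 2 * Vmu r.
Proof.
  intros Hr. pose proof (rho_le_Vmu_aux r Hr) as H. unfold low_nonzero in H.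
  destruct (Nat.eqb (r mod b) 0); lra.
Qed.

Lemma rho_pos (r : nat) : (1 <= r)%nat -> 1 <= INR (rho b r).
Proof.
  intros Hr. apply (le_INR 1). unfold rho.
  pose proof (Nat.div_mod_eq r b) as En.
  rewrite En, digits_rec; [simpl; lia|assumption|apply Nat.mod_upper_bound; lia|lia].
Qed.

Lemma mean_mu_0 (r : nat) : mean_mu b r = 0.
Proof.
  rewrite <- (Emu_id r). apply zsum_ext. intros; ring.
Qed.

Lemma var_mu_Vmu (r : nat) : var_mu b r = Vmu r.
Proof.
  unfold var_mu. rewrite mean_mu_0. apply zsum_ext. intros; ring.
Qed.

End Moments.

(** * Gaussian tails *)

Lemma sqrt_2PI_ge_1 : 1 <= sqrt (2 * PI).
Proof.
  rewrite <- sqrt_1 at 1. apply sqrt_le_1_alt. pose proof PI2_3_2. lra.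
Qed.

Lemma phi_pos (x : R) : 0 < phi x.
Proof. apply Rdiv_lt_0_compat; [apply exp_pos|pose proof sqrt_2PI_ge_1; lra]. Qed.

Lemma phi_le_exp (x : R) : phi x <= exp (- x ^ 2 / 2).
Proof.
  unfold phi. pose proof (exp_pos (- x ^ 2 / 2)). pose proof sqrt_2PI_ge_1.
  apply Rle_div_l; nra.
Qed.

Lemma phi_le_1 (x : R) : phi x <= 1.
Proof.
  eapply Rle_trans; [apply phi_le_exp|]. rewrite <- exp_0.
  destruct (Req_dec x 0) as [->|H].
  - apply Req_le. f_equal. lra.
  - apply Rlt_le, exp_increasing. pose proof (pow2_gt_0 x H). lra.
Qed.

Lemma phi_opp (x : R) : phi (- x) = phi x.
Proof. unfold phi. now replace ((- x) ^ 2) with (x ^ 2) by ring. Qed.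

Lemma is_derive_phi (x : R) : is_derive phi x (- x * phi x).
Proof.
  unfold phi. auto_derive; [trivial|].
  pose proof sqrt_2PI_ge_1. simpl (x ^ 2). unfold Rdiv. field. lra.
Qed.

Lemma continuous_phi (x : R) : continuous phi x.
Proof. apply @ex_derive_continuous. eexists. apply is_derive_phi. Qed.

(** Chosen so that [- tail] is an explicit antiderivative of [(x ^ 3 + x) * phi x], which dominates,
    up to a constant, every cubic function times [phi] on [x >= 1]. *)
Definition tail (x : R) : R := (x ^ 2 + 3) * phi x.

Lemma is_derive_tail (x : R) : is_derive (fun y => - tail y) x ((x ^ 3 + x) * phi x).
Proof.
  unfold tail.
  replace ((x ^ 3 + x) * phi x)
    with (- ((2 * x) * phi x + (x ^ 2 + 3) * (- x * phi x))) by ring.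
  apply @is_derive_opp.
  apply (is_derive_mult (fun x => x ^ 2 + 3) phi x (2 * x) (- x * phi x)).
  - auto_derive; [trivial|ring].
  - apply is_derive_phi.
  - intros; apply Rmult_comm.
Qed.

Lemma tail_nonneg (x : R) : 0 <= tail x.
Proof. unfold tail. pose proof (phi_pos x). nra. Qed.

(** From [exp (2 u) >= (1 + u) ^ 2] with [u = x ^ 2 / 4]. This crude decay is enough for passing to
    limits. *)
Lemma tail_le (x : R) : 1 <= x -> tail x <= 16 / x.
Proof.
  intros Hx. unfold tail.
  assert (H1 : (1 + x ^ 2 / 4) ^ 2 <= exp (x ^ 2 / 2)).
  { replace (x ^ 2 / 2) with (x ^ 2 / 4 + x ^ 2 / 4) by field.
    rewrite exp_plus. pose proof (exp_ineq1_le (x ^ 2 / 4)). nra. }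
  pose proof (phi_le_exp x) as H2.
  replace (- x ^ 2 / 2) with (- (x ^ 2 / 2)) in H2 by field. rewrite exp_Ropp in H2.
  assert (H3 : / exp (x ^ 2 / 2) <= / (1 + x ^ 2 / 4) ^ 2)
    by (apply Rinv_le_contravar; [apply pow_lt; nra|assumption]).
  apply Rle_trans with ((x ^ 2 + 3) * / (1 + x ^ 2 / 4) ^ 2).
  - apply Rmult_le_compat_l; [nra|lra].
  - apply (Rle_div_r _ 16 x); [lra|].
    replace ((x ^ 2 + 3) * / (1 + x ^ 2 / 4) ^ 2 * x)
      with ((x ^ 2 + 3) * x / (1 + x ^ 2 / 4) ^ 2) by (unfold Rdiv; ring).
    apply Rle_div_l; [apply pow_lt; nra|].
    assert (x ^ 3 <= x ^ 4) by (apply Rle_pow; [assumption|lia]). nra.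
Qed.

Lemma continuous_Rmult (f g : R -> R) (x : R) :
  continuous f x -> continuous g x -> continuous (fun y => f y * g y) x.
Proof. intros F G. exact (continuous_mult (K := R_AbsRing) f g x F G). Qed.

Lemma ex_RInt_phi_mul (k : R -> R) (a b : R) : (forall x, continuous k x) ->
  ex_RInt (fun x => k x * phi x) a b.
Proof.
  intros Hk. apply @ex_RInt_continuous. intros x _.
  apply continuous_Rmult; [apply Hk|apply continuous_phi].
Qed.

Lemma RInt_tail (k : R -> R) (A x y : R) : (forall z, continuous k z) ->
  (forall z, Rabs (k z) <= A * (1 + Rabs z) ^ 3) -> 1 <= x <= y ->
  Rabs (RInt (fun t => k t * phi t) x y) <= 8 * A * tail x.
Proof.
  intros Hk HA Hx.
  assert (A0 : 0 <= A).
  { specialize (HA 0). rewrite Rabs_R0 in HA. pose proof (Rabs_pos (k 0)). lra. }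
  assert (D : is_RInt (fun t => 8 * A * ((t ^ 3 + t) * phi t)) x y
                (8 * A * (- tail y - - tail x))).
  { apply @is_RInt_scal. apply (is_RInt_derive (fun y => - tail y)).
    - intros z _. apply is_derive_tail.
    - intros z _. apply continuous_Rmult; [|apply continuous_phi].
      apply @ex_derive_continuous. auto_derive. trivial. }
  apply Rle_trans with (8 * A * (- tail y - - tail x)).
  - refine (norm_RInt_le (V := R_NormedModule) (fun t => k t * phi t) _ x y _ _ (proj2 Hx) _
      (RInt_correct _ _ _ (ex_RInt_phi_mul k x y Hk)) D).
    intros z Hz. change (Rabs (k z * phi z) <= 8 * A * ((z ^ 3 + z) * phi z)).
    rewrite Rabs_mult, (Rabs_pos_eq (phi z)) by apply Rlt_le, phi_pos.
    rewrite <- Rmult_assoc. apply Rmult_le_compat_r; [apply Rlt_le, phi_pos|].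
    eapply Rle_trans; [apply HA|]. rewrite Rabs_pos_eq by lra.
    rewrite (Rmult_comm 8 A), Rmult_assoc. apply Rmult_le_compat_l; [assumption|].
    assert ((1 + z) ^ 3 <= (2 * z) ^ 3) by (apply pow_incr; lra).
    replace ((2 * z) ^ 3) with (8 * z ^ 3) in H by ring. lra.
  - pose proof (tail_nonneg y). nra.
Qed.

Lemma RInt_Chasles_phi (k : R -> R) (a x y : R) : (forall z, continuous k z) ->
  RInt (fun t => k t * phi t) a y - RInt (fun t => k t * phi t) a x
  = RInt (fun t => k t * phi t) x y.
Proof.
  intros Hk.
  rewrite <- (RInt_Chasles (V := R_CompleteNormedModule) (fun t => k t * phi t) a x y)
    by now apply ex_RInt_phi_mul.
  unfold plus; simpl. ring.
Qed.

(** The explicit rate serves twice: it gives convergence, and after division by [phi] it becomes the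
    polynomial growth bound for the Stein solution. *)
Lemma RInt_lim_right (k : R -> R) : (forall z, continuous k z) -> cubic k ->
  exists L C : R, 0 <= C /\
    (forall x, 1 <= x -> Rabs (L - RInt (fun t => k t * phi t) 0 x) <= C * tail x).
Proof.
  intros Hk [A HA].
  assert (A0 : 0 <= A).
  { specialize (HA 0). rewrite Rabs_R0 in HA. pose proof (Rabs_pos (k 0)). lra. }
  set (K := fun x => RInt (fun t => k t * phi t) 0 x).
  assert (HK : forall x y, 1 <= x <= y -> Rabs (K y - K x) <= 8 * A * tail x).
  { intros x y Hx. unfold K. rewrite RInt_Chasles_phi by assumption. now apply RInt_tail. }
  assert (Hc : ex_finite_lim_seq (fun n => K (INR n + 1))).
  { apply ex_lim_seq_cauchy_corr. intros eps.
    assert (Heps := cond_pos eps).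
    destruct (nfloor_ex (128 * A / eps)) as [N HN].
    { apply Rdiv_le_0_compat; lra. }
    assert (T : forall n, (N <= n)%nat -> 8 * A * tail (INR n + 1) < eps).
    { intros n Hn. apply le_INR in Hn. pose proof (pos_INR N).
      assert (Hlt : 128 * A < eps * (INR n + 1)).
      { destruct HN as [_ HN]. apply Rlt_div_l in HN; [|lra]. nra. }
      apply Rle_lt_trans with (8 * A * (16 / (INR n + 1))).
      - apply Rmult_le_compat_l; [lra|]. apply tail_le. lra.
      - replace (8 * A * (16 / (INR n + 1))) with (128 * A / (INR n + 1)) by (field; lra).
        apply Rlt_div_l; lra. }
    exists N. intros n m Hn Hm.
    destruct (Nat.le_ge_cases n m) as [L|L]; apply le_INR in L.
    - rewrite Rabs_minus_sym. pose proof (pos_INR n).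
      eapply Rle_lt_trans; [apply HK; lra|]. now apply T.
    - pose proof (pos_INR m).
      eapply Rle_lt_trans; [apply HK; lra|]. now apply T. }
  destruct Hc as [L HL]. exists L, (8 * A). split; [lra|]. intros x Hx.
  change (Rabs (L - K x) <= 8 * A * tail x).
  destruct (nfloor_ex x) as [N HN]; [lra|].
  apply (is_lim_seq_le_loc (fun n => Rabs (K (INR n + 1) - K x)) (fun _ => 8 * A * tail x)
           (Rabs (L - K x)) (8 * A * tail x)).
  - exists N. intros n Hn. apply HK. apply le_INR in Hn. lra.
  - apply (is_lim_seq_abs _ (L - K x)). apply is_lim_seq_minus'; [assumption|apply is_lim_seq_const].
  - apply is_lim_seq_const.
Qed.

Lemma RInt_opp_phi (k : R -> R) (x : R) : (forall z, continuous k z) ->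
  RInt (fun t => k t * phi t) 0 (- x) = RInt (fun t => - k (- t) * phi t) 0 x.
Proof.
  intros Hk. symmetry. apply is_RInt_unique.
  apply is_RInt_ext with (fun y => opp ((fun t => k t * phi t) (- y))).
  - intros y _. rewrite phi_opp. unfold opp; simpl. ring.
  - apply (is_RInt_comp_opp (fun t => k t * phi t) 0 x).
    rewrite Ropp_0. apply @RInt_correct, ex_RInt_phi_mul, Hk.
Qed.

Lemma RInt_lim_left (k : R -> R) : (forall z, continuous k z) -> cubic k ->
  exists L C : R, 0 <= C /\
    (forall x, x <= -1 -> Rabs (L - RInt (fun t => k t * phi t) 0 x) <= C * tail x).
Proof.
  intros Hk Hc.
  destruct (RInt_lim_right (fun t => - k (- t))) as [L [C [HC H]]].
  - intros z. apply (continuous_opp (V := R_NormedModule) (fun t => k (- t)) z).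
    apply continuous_comp with (f := fun t => - t).
    + apply (continuous_opp (V := R_NormedModule) (fun t => t) z), continuous_id.
    + apply Hk.
  - destruct Hc as [A HA]. exists A. intros x. rewrite Rabs_Ropp, <- (Rabs_Ropp x). apply HA.
  - exists L, C. split; [assumption|]. intros x Hx.
    specialize (H (- x) ltac:(lra)).
    replace (tail x) with (tail (- x)).
    2: { unfold tail. rewrite phi_opp. ring. }
    rewrite <- (Ropp_involutive x) at 1. now rewrite RInt_opp_phi.
Qed.

Lemma tail_lt_eventually (C : R) (eps : posreal) : 0 <= C ->
  exists X, 1 <= X /\ forall x, X < Rabs x -> C * tail x < eps.
Proof.
  intros HC. assert (Heps := cond_pos eps).
  exists (1 + 16 * C / eps).
  assert (H0 : 0 <= 16 * C / eps) by (apply Rdiv_le_0_compat; lra).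
  split; [lra|]. intros x Hx.
  assert (Ht : tail x = tail (Rabs x)).
  { unfold Rabs. destruct (Rcase_abs x); [|reflexivity].
    unfold tail. rewrite phi_opp. ring. }
  rewrite Ht. set (y := Rabs x) in *.
  apply Rle_lt_trans with (C * (16 / y)).
  - apply Rmult_le_compat_l; [assumption|apply tail_le; lra].
  - assert (16 * C < y * eps) by (apply Rlt_div_l; lra).
    replace (C * (16 / y)) with (16 * C / y) by (field; lra).
    apply Rlt_div_l; lra.
Qed.

Lemma is_RInt_gen_of_limits (k : R -> R) (Lp Lm Cp Cm : R) : (forall z, continuous k z) ->
  0 <= Cp -> 0 <= Cm ->
  (forall x, 1 <= x -> Rabs (Lp - RInt (fun t => k t * phi t) 0 x) <= Cp * tail x) ->
  (forall x, x <= -1 -> Rabs (Lm - RInt (fun t => k t * phi t) 0 x) <= Cm * tail x) ->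
  is_RInt_gen (fun t => k t * phi t) (Rbar_locally m_infty) (Rbar_locally p_infty) (Lp - Lm).
Proof.
  intros Hk HCp HCm Hp Hm P [eps HP].
  destruct (tail_lt_eventually Cp (pos_div_2 eps) HCp) as [Xp [X1 HXp]].
  destruct (tail_lt_eventually Cm (pos_div_2 eps) HCm) as [Xm [X2 HXm]].
  apply Filter_prod with (fun x => x < - Xm) (fun x => Xp < x).
  - now exists (- Xm).
  - now exists Xp.
  - intros x y Hx Hy. exists (RInt (fun t => k t * phi t) x y). split.
    + apply @RInt_correct, ex_RInt_phi_mul, Hk.
    + apply HP. rewrite <- (RInt_Chasles_phi k 0) by assumption.
      specialize (HXp y ltac:(rewrite Rabs_pos_eq; lra)).
      specialize (HXm x ltac:(rewrite Rabs_left1; lra)).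
      specialize (Hp y ltac:(lra)). specialize (Hm x ltac:(lra)).
      apply Rabs_between in Hp, Hm. simpl in HXp, HXm.
      change (Rabs (RInt (fun t => k t * phi t) 0 y - RInt (fun t => k t * phi t) 0 x
        - (Lp - Lm)) < eps).
      apply Rabs_lt_between. lra.
Qed.

(** * The Gaussian integral *)

(** The classical auxiliary integrand for the Gaussian integral. At [x = 0] it is the derivative of
    [atan]; its integral over [[0, 1]] vanishes as [x] grows, while its [x]-derivative integrates to
    a multiple of [phi x * Gint x]. *)
Definition gauss_aux (x t : R) : R := exp (- (x ^ 2 * (1 + t ^ 2)) / 2) / (1 + t ^ 2).

Lemma is_derive_gauss_aux (x t : R) :
  is_derive (fun u => gauss_aux u t) x (- x * exp (- (x ^ 2 * (1 + t ^ 2)) / 2)).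
Proof.
  unfold gauss_aux. auto_derive; [trivial|]. simpl pow. unfold Rdiv. field. nra.
Qed.

Lemma continuous_gauss_aux (x t : R) : continuous (gauss_aux x) t.
Proof.
  apply @ex_derive_continuous. unfold gauss_aux. auto_derive. nra.
Qed.

Lemma is_derive_RInt_gauss_aux (x : R) :
  is_derive (fun x => RInt (gauss_aux x) 0 1) x
    (RInt (fun t => - x * exp (- (x ^ 2 * (1 + t ^ 2)) / 2)) 0 1).
Proof.
  replace (RInt (fun t => - x * exp (- (x ^ 2 * (1 + t ^ 2)) / 2)) 0 1)
    with (RInt (fun t => Derive (fun u => gauss_aux u t) x) 0 1).
  2: { apply RInt_ext. intros t _. apply is_derive_unique, is_derive_gauss_aux. }
  apply (is_derive_RInt_param gauss_aux 0 1 x).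
  - apply filter_forall. intros y t _. eexists. apply is_derive_gauss_aux.
  - intros t _.
    apply continuity_2d_pt_ext with
      (fun u v => (- u) * exp ((fun u v => - (u ^ 2 * (1 + v ^ 2)) / 2) u v)).
    { intros u v. symmetry. apply is_derive_unique, is_derive_gauss_aux. }
    apply continuity_2d_pt_mult.
    + apply continuity_2d_pt_opp, continuity_2d_pt_id1.
    + apply continuity_1d_2d_pt_comp.
      * apply derivable_continuous_pt, derivable_pt_exp.
      * apply continuity_2d_pt_ext with (fun u v => ((u * u) * (1 + v * v)) * (- / 2)).
        { intros u v. field. }
        repeat first [ apply continuity_2d_pt_mult | apply continuity_2d_pt_plus
          | apply continuity_2d_pt_id1 | apply continuity_2d_pt_id2
          | apply continuity_2d_pt_const ].
  - apply filter_forall. intros y. apply @ex_RInt_continuous. intros t _.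
    apply continuous_gauss_aux.
Qed.

Definition Gint (x : R) : R := RInt phi 0 x.

Lemma is_derive_Gint (x : R) : is_derive Gint x (phi x).
Proof.
  apply (is_derive_RInt phi Gint 0 x).
  - apply filter_forall. intros y. apply @RInt_correct, @ex_RInt_continuous.
    intros z _. apply continuous_phi.
  - apply continuous_phi.
Qed.

Lemma Gint_scaled (x : R) : Gint x = RInt (fun t => x * phi (x * t)) 0 1.
Proof.
  unfold Gint. symmetry.
  replace (RInt phi 0 x) with (RInt phi (x * 0 + 0) (x * 1 + 0)) by (f_equal; ring).
  rewrite <- (RInt_comp_lin phi x 0 0 1).
  - apply RInt_ext. intros t _. unfold scal; simpl; unfold mult; simpl. now rewrite Rplus_0_r.
  - apply @ex_RInt_continuous. intros z _. apply continuous_phi.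
Qed.

Lemma RInt_gauss_aux_deriv (x : R) :
  RInt (fun t => - x * exp (- (x ^ 2 * (1 + t ^ 2)) / 2)) 0 1 = - (2 * PI * phi x * Gint x).
Proof.
  rewrite Gint_scaled.
  assert (X : ex_RInt (fun t => x * phi (x * t)) 0 1).
  { apply @ex_RInt_continuous. intros z _. apply continuous_Rmult; [apply continuous_const|].
    apply continuous_comp with (f := fun t => x * t); [|apply continuous_phi].
    apply continuous_Rmult; [apply continuous_const|apply continuous_id]. }
  apply is_RInt_unique. rewrite Ropp_mult_distr_l.
  apply is_RInt_ext with (fun t => - (2 * PI * phi x) * (x * phi (x * t))).
  - intros t _. symmetry. unfold phi.
    pose proof sqrt_2PI_ge_1 as S1. pose proof PI_RGT_0.
    assert (S2 : sqrt (2 * PI) * sqrt (2 * PI) = 2 * PI) by (apply sqrt_sqrt; lra).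
    replace (exp (- (x ^ 2 * (1 + t ^ 2)) / 2))
      with (exp (- x ^ 2 / 2) * exp (- (x * t) ^ 2 / 2)).
    2: { rewrite <- exp_plus. f_equal. field. }
    set (s := sqrt (2 * PI)) in *. rewrite <- S2.
    match goal with |- ?u = ?v => change (@eq R u v) end. field. lra.
  - exact (is_RInt_scal (V := R_NormedModule) _ 0 1 (- (2 * PI * phi x)) _
      (RInt_correct (V := R_CompleteNormedModule) _ _ _ X)).
Qed.

(* The derivative of [PI * Gint ^ 2 + RInt gauss_aux] vanishes. *)
Lemma Gint_identity (x : R) : PI * Gint x ^ 2 + RInt (gauss_aux x) 0 1 = PI / 4.
Proof.
  assert (D : forall y, is_derive (fun y => PI * Gint y ^ 2 + RInt (gauss_aux y) 0 1) y 0).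
  { intros y.
    assert (D' : is_derive (fun y => PI * Gint y ^ 2 + RInt (gauss_aux y) 0 1) y
      (PI * (2 * phi y * Gint y) + - (2 * PI * phi y * Gint y))).
    { apply (is_derive_plus (fun y => PI * Gint y ^ 2)).
      - apply is_derive_scal.
        replace (2 * phi y * Gint y) with (INR 2 * phi y * Gint y ^ Init.Nat.pred 2)
          by (simpl; ring).
        apply is_derive_pow, is_derive_Gint.
      - rewrite <- RInt_gauss_aux_deriv. apply is_derive_RInt_gauss_aux. }
    replace (PI * (2 * phi y * Gint y) + - (2 * PI * phi y * Gint y)) with 0 in D' by ring.
    exact D'. }
  assert (E : PI * Gint x ^ 2 + RInt (gauss_aux x) 0 1
            = PI * Gint 0 ^ 2 + RInt (gauss_aux 0) 0 1).
  { destruct (MVT_gen (fun y => PI * Gint y ^ 2 + RInt (gauss_aux y) 0 1) 0 x (fun _ => 0))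
      as [c [_ Hc]].
    - intros; apply D.
    - intros y _. apply continuity_pt_filterlim.
      apply (ex_derive_continuous (fun y => PI * Gint y ^ 2 + RInt (gauss_aux y) 0 1)).
      eexists; apply D.
    - lra. }
  rewrite E.
  replace (Gint 0) with 0.
  2: { unfold Gint. now rewrite RInt_point. }
  replace (RInt (gauss_aux 0) 0 1) with (PI / 4); [ring|].
  symmetry. apply is_RInt_unique.
  replace (PI / 4) with (minus (atan 1) (atan 0)).
  2: { rewrite atan_1, atan_0. unfold minus, plus, opp; simpl. ring. }
  apply (is_RInt_derive atan).
  - intros t _. replace (gauss_aux 0 t) with (/ (1 + t ^ 2)).
    + rewrite <- Rsqr_pow2. apply is_derive_atan.
    + unfold gauss_aux. replace (- (0 ^ 2 * (1 + t ^ 2)) / 2) with 0 by field.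
      rewrite exp_0. unfold Rdiv. ring.
  - intros t _. apply continuous_gauss_aux.
Qed.

Lemma RInt_gauss_aux_bound (x : R) : 0 <= RInt (gauss_aux x) 0 1 <= exp (- x ^ 2 / 2).
Proof.
  assert (X : ex_RInt (gauss_aux x) 0 1).
  { apply @ex_RInt_continuous. intros; apply continuous_gauss_aux. }
  assert (P : forall t, 0 < exp (- (x ^ 2 * (1 + t ^ 2)) / 2) <= exp (- x ^ 2 / 2)).
  { intros t. split; [apply exp_pos|]. pose proof (pow2_ge_0 (x * t)).
    destruct (Req_dec (x * t) 0) as [E|E].
    - apply Req_le. f_equal. replace (x ^ 2 * (1 + t ^ 2)) with (x ^ 2 + (x * t) ^ 2) by ring.
      rewrite E. field.
    - apply Rlt_le, exp_increasing. pose proof (pow2_gt_0 _ E).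
      replace (x ^ 2 * (1 + t ^ 2)) with (x ^ 2 + (x * t) ^ 2) by ring. lra. }
  split.
  - apply RInt_ge_0; [lra|assumption|]. intros t _. unfold gauss_aux.
    apply Rdiv_le_0_compat; [apply Rlt_le, P|nra].
  - replace (exp (- x ^ 2 / 2)) with (RInt (fun _ => exp (- x ^ 2 / 2)) 0 1).
    2: { rewrite RInt_const. unfold scal; simpl; unfold mult; simpl. ring. }
    apply RInt_le; [lra|assumption|apply ex_RInt_const|].
    intros t _. unfold gauss_aux. destruct (P t).
    apply Rle_div_l; [nra|]. pose proof (exp_pos (- x ^ 2 / 2)). nra.
Qed.

Lemma Gint_phi_form (x : R) : RInt (fun t => 1 * phi t) 0 x = Gint x.
Proof. apply RInt_ext. intros; apply Rmult_1_l. Qed.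

Lemma Gint_nonneg (x : R) : 0 <= x -> 0 <= Gint x.
Proof.
  intros Hx. apply RInt_ge_0; [assumption| |intros; apply Rlt_le, phi_pos].
  apply @ex_RInt_continuous. intros; apply continuous_phi.
Qed.

Lemma Gint_sq_near (x : R) : Rabs (Gint x ^ 2 - / 4) <= exp (- x ^ 2 / 2).
Proof.
  pose proof (Gint_identity x) as H. pose proof (RInt_gauss_aux_bound x) as [H1 H2].
  pose proof PI2_3_2.
  set (j := RInt (gauss_aux x) 0 1) in *. set (g := Gint x ^ 2) in *.
  assert (E : PI * (g - / 4) = - j) by lra.
  apply Rabs_le. split; nra.
Qed.

(** [Gint_identity] determines only the square of the half-line integral, [L ^ 2 = 1 / 4].
    Positivity of the integrand fixes the sign, and symmetry doubles the result. *)
Lemma phi_integral : is_RInt_gen (fun t => 1 * phi t) (Rbar_locally m_infty) (Rbar_locally p_infty) 1.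
Proof.
  assert (Hk : forall z : R, continuous (fun _ : R => 1) z) by (intros; apply continuous_const).
  destruct (RInt_lim_right (fun _ => 1) Hk (cubic_const 1)) as [L [C [HC H]]].
  assert (EL : L = / 2).
  { assert (L0 : 0 <= L).
    { apply le_epsilon. intros e He.
      destruct (tail_lt_eventually C (mkposreal e He) HC) as [X [X1 HX]].
      specialize (HX (X + 1) ltac:(rewrite Rabs_pos_eq; lra)). simpl in HX.
      specialize (H (X + 1) ltac:(lra)). rewrite Gint_phi_form in H.
      apply Rabs_between in H. pose proof (Gint_nonneg (X + 1) ltac:(lra)). lra. }
    assert (L2 : Rabs (L ^ 2 - / 4) <= 0).
    { apply le_epsilon. intros e He. rewrite Rplus_0_l.
      (* If [d] is this minimum and [|L - g| <= d <= 1], then [L ^ 2] is within [d * (2 * L + 1)] of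
         [g ^ 2], and [g ^ 2] is within [d] of [1 / 4]. *)
      assert (He' : 0 < Rmin 1 (e / (2 * (2 * L + 3)))).
      { apply Rmin_pos; [lra|]. apply Rdiv_lt_0_compat; lra. }
      destruct (tail_lt_eventually (C + 3) (mkposreal _ He') ltac:(lra)) as [X [X1 HX]].
      specialize (HX (X + 1) ltac:(rewrite Rabs_pos_eq; lra)). simpl in HX.
      specialize (H (X + 1) ltac:(lra)). rewrite Gint_phi_form in H.
      pose proof (Gint_sq_near (X + 1)) as H1.
      assert (Hexp : exp (- (X + 1) ^ 2 / 2) <= 3 * tail (X + 1)).
      { unfold tail, phi. pose proof sqrt_2PI_ge_1.
        assert (S4 : sqrt (2 * PI) <= 3).
        { replace 3 with (sqrt (3 * 3)) by (apply sqrt_square; lra).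
          apply sqrt_le_1_alt. pose proof PI_4. lra. }
        pose proof (exp_pos (- (X + 1) ^ 2 / 2)).
        set (w := exp (- (X + 1) ^ 2 / 2)) in *.
        replace (3 * (((X + 1) ^ 2 + 3) * (w / sqrt (2 * PI))))
          with (3 * ((X + 1) ^ 2 + 3) * w / sqrt (2 * PI)) by (unfold Rdiv; ring).
        apply (Rle_div_r w _ (sqrt (2 * PI))); [lra|]. nra. }
      pose proof (tail_nonneg (X + 1)) as T0.
      set (t := tail (X + 1)) in *. set (g := Gint (X + 1)) in *.
      assert (Hm1 := Rmin_l 1 (e / (2 * (2 * L + 3)))).
      assert (Hm2 := Rmin_r 1 (e / (2 * (2 * L + 3)))).
      set (d := Rmin 1 (e / (2 * (2 * L + 3)))) in *.
      assert (Hd : d * (2 * (2 * L + 3)) <= e) by (apply Rle_div_r; lra).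
      apply Rabs_between in H, H1.
      assert (Hg : Rabs (L ^ 2 - g ^ 2) <= d * (2 * L + 1)).
      { replace (L ^ 2 - g ^ 2) with ((L - g) * (2 * L - (L - g))) by ring.
        rewrite Rabs_mult. apply Rmult_le_compat; try apply Rabs_pos; apply Rabs_le; nra. }
      apply Rabs_between in Hg. apply Rabs_le. nra. }
    assert (L ^ 2 - / 4 = 0) by (apply Rabs_between in L2; lra).
    assert ((L - / 2) * (L + / 2) = 0) by lra.
    apply Rmult_integral in H1. lra. }
  cut (is_RInt_gen (fun t => 1 * phi t) (Rbar_locally m_infty) (Rbar_locally p_infty) (L - - L)).
  { replace (L - - L) with 1 by lra. trivial. }
  apply is_RInt_gen_of_limits with C C; auto.
  intros x Hx. replace (tail x) with (tail (- x)) by (unfold tail; rewrite phi_opp; ring).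
  specialize (H (- x) ltac:(lra)).
  rewrite <- (Ropp_involutive x) at 1.
  rewrite (RInt_opp_phi (fun _ => 1)) by assumption.
  assert (Eo : RInt (fun t => Ropp 1 * phi t) 0 (- x) = - RInt (fun t => 1 * phi t) 0 (- x)).
  { apply is_RInt_unique. apply is_RInt_ext with (fun t => opp (1 * phi t)).
    - intros t _. change (- (1 * phi t) = Ropp 1 * phi t). ring.
    - apply (is_RInt_opp (V := R_NormedModule)).
      apply @RInt_correct, (ex_RInt_phi_mul (fun _ => 1)), Hk. }
  cbv beta. rewrite Eo, <- Rabs_Ropp.
  replace (- (- L - - RInt (fun t => 1 * phi t) 0 (- x)))
    with (L - RInt (fun t => 1 * phi t) 0 (- x)) by ring.
  exact H.
Qed.

(** * The Stein equation *)

Lemma is_derive_continuous (f : R -> R) (x l : R) : is_derive f x l -> continuous f x.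
Proof. intros H. apply @ex_derive_continuous. now exists l. Qed.

Lemma mvt (f f1 : R -> R) (x y : R) : (forall z, is_derive f z (f1 z)) ->
  exists c, Rmin x y <= c <= Rmax x y /\ f y - f x = f1 c * (y - x).
Proof.
  intros H. apply (MVT_gen f x y f1).
  - intros; apply H.
  - intros z _. apply continuity_pt_filterlim. apply (is_derive_continuous f z (f1 z)), H.
Qed.

(** * The maximum principle for [w'' - x w' - 3 w] *)

Lemma interior_max_first_order (z z1 : R -> R) (a b x0 : R) :
  is_derive z x0 (z1 x0) -> a < x0 < b ->
  (forall x, a <= x <= b -> z x <= z x0) -> z1 x0 = 0.
Proof.
  intros H Hx Hmax. apply is_derive_Reals in H.
  assert (pr : derivable_pt z x0) by (exists (z1 x0); exact H).
  rewrite <- (derive_pt_eq_0 z x0 (z1 x0) pr H).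
  apply (deriv_maximum z a b x0 pr); try lra.
  intros x H1 H2. apply Hmax. lra.
Qed.

Lemma interior_max_second_order (z z1 : R -> R) (a b x0 l : R) :
  (forall x, is_derive z x (z1 x)) -> is_derive z1 x0 l -> a < x0 < b ->
  (forall x, a <= x <= b -> z x <= z x0) -> l <= 0.
Proof.
  intros H H1 Hx Hmax.
  pose proof (interior_max_first_order z z1 a b x0 (H x0) Hx Hmax) as Z0.
  apply Rnot_lt_le. intros Hl.
  apply is_derive_Reals in H1. destruct (H1 l Hl) as [d Hd]. assert (d0 := cond_pos d).
  set (y := x0 + Rmin (d / 2) (b - x0)).
  assert (Hm : 0 < Rmin (d / 2) (b - x0)) by (apply Rmin_pos; lra).
  assert (Hm1 := Rmin_l (d / 2) (b - x0)). assert (Hm2 := Rmin_r (d / 2) (b - x0)).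
  destruct (MVT_cor2 z z1 x0 y) as [c [E Hc]].
  - unfold y; lra.
  - intros c _. apply is_derive_Reals, H.
  - assert (Hc0 : 0 < c - x0) by lra.
    specialize (Hd (c - x0)). rewrite Z0 in Hd.
    replace (x0 + (c - x0)) with c in Hd by ring.
    specialize (Hd ltac:(lra) ltac:(rewrite Rabs_pos_eq; unfold y in Hc; lra)).
    apply Rabs_lt_between in Hd.
    assert (Hq : 0 < (z1 c - 0) / (c - x0)) by lra.
    assert (Hz : 0 < z1 c).
    { replace (z1 c) with ((z1 c - 0) / (c - x0) * (c - x0)) by (field; lra).
      now apply Rmult_lt_0_compat. }
    specialize (Hmax y ltac:(unfold y; lra)).
    assert (0 < z1 c * (y - x0)) by (apply Rmult_lt_0_compat; unfold y in *; lra).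
    lra.
Qed.

(* [x^6 + 17] is a strict supersolution, and dominates the growth allowed for [w]. *)
Lemma max_principle_upper (w w1 w2 : R -> R) (M A : R) :
  (forall x, is_derive w x (w1 x)) -> (forall x, is_derive w1 x (w2 x)) ->
  (forall x, Rabs (w2 x - x * w1 x - 3 * w x) <= M) ->
  (forall x, 1 <= Rabs x -> Rabs (w x) <= A * x ^ 4) ->
  forall x, w x <= M / 3.
Proof.
  intros D1 D2 HM HA x.
  assert (M0 : 0 <= M) by (eapply Rle_trans; [apply Rabs_pos|apply (HM 0)]).
  assert (A0 : 0 <= A).
  { specialize (HA 1 ltac:(rewrite Rabs_R1; lra)). pose proof (Rabs_pos (w 1)). lra. }
  apply le_epsilon. intros e He.
  set (eps := e / (x ^ 6 + 17)).
  assert (Hx6 : 0 < x ^ 6 + 17).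
  { replace (x ^ 6) with ((x ^ 3) ^ 2) by ring. pose proof (pow2_ge_0 (x ^ 3)). lra. }
  assert (Heps : 0 < eps) by (apply Rdiv_lt_0_compat; lra).
  set (z := fun y => w y - eps * (y ^ 6 + 17)).
  set (z1 := fun y => w1 y - eps * (6 * y ^ 5)).
  assert (Dz : forall y, is_derive z y (z1 y)).
  { intros y. apply (is_derive_minus w (fun y => eps * (y ^ 6 + 17))); [apply D1|].
    auto_derive; [trivial|]. ring. }
  assert (Dz1 : forall y, is_derive z1 y (w2 y - eps * (30 * y ^ 4))).
  { intros y. apply (is_derive_minus w1 (fun y => eps * (6 * y ^ 5))); [apply D2|].
    auto_derive; [trivial|]. ring. }
  (* The interval contains [x] and is so long that [eps * X ^ 2 >= A]; at its ends [eps * y ^ 6]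
     beats [A * y ^ 4]. *)
  set (X := 1 + Rabs x + A / eps).
  assert (HX : 1 <= X /\ Rabs x <= X /\ A / eps <= X).
  { pose proof (Rabs_pos x). assert (0 <= A / eps) by (apply Rdiv_le_0_compat; lra).
    unfold X. lra. }
  destruct HX as [HX1 [HX2 HX3]].
  assert (HAX : A <= eps * X ^ 2).
  { apply Rle_div_l in HX3; [|lra]. assert (0 <= X * (X - 1)) by nra. nra. }
  assert (Hend : forall y, Rabs y = X -> z y <= 0).
  { intros y Hy. unfold z. specialize (HA y ltac:(lra)).
    apply Rabs_between in HA.
    assert (E2 : y ^ 2 = X ^ 2) by (rewrite <- Hy, pow2_abs; reflexivity).
    replace (y ^ 6) with (y ^ 2 * y ^ 4) by ring. rewrite E2.
    assert (0 <= y ^ 4) by (replace (y ^ 4) with ((y ^ 2) ^ 2) by ring; apply pow2_ge_0).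
    assert (A * y ^ 4 <= eps * X ^ 2 * y ^ 4) by (apply Rmult_le_compat_r; assumption).
    lra. }
  destruct (continuity_ab_maj z (- X) X ltac:(lra)) as [x0 [Hmax Hx0]].
  { intros c _. apply continuity_pt_filterlim, (is_derive_continuous z c (z1 c)), Dz. }
  assert (Hz0 : z x0 <= M / 3).
  { destruct (Req_dec x0 X) as [E|N1].
    { apply Rle_trans with 0; [|lra]. apply Hend. rewrite E, Rabs_pos_eq; lra. }
    destruct (Req_dec x0 (- X)) as [E|N2].
    { apply Rle_trans with 0; [|lra]. apply Hend. rewrite E, Rabs_left1; lra. }
    assert (Hi : - X < x0 < X) by lra.
    pose proof (interior_max_first_order z z1 (- X) X x0 (Dz x0) Hi Hmax) as F1.
    pose proof (interior_max_second_order z z1 (- X) X x0 _ Dz (Dz1 x0) Hi Hmax) as F2.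
    specialize (HM x0). apply Rabs_between in HM. unfold z1 in F1. unfold z.
    (* In [u = x0 ^ 2], the polynomial [30 u ^ 2 - 9 u ^ 3] has its maximum over [u >= 0] at
       [u = 20 / 9], with value [4000 / 81 < 51 = 3 * 17]. Hence the constant 17. *)
    assert (Bar : 30 * x0 ^ 4 - 6 * x0 ^ 6 - 3 * (x0 ^ 6 + 17) <= 0).
    { replace (x0 ^ 4) with ((x0 ^ 2) ^ 2) by ring.
      replace (x0 ^ 6) with ((x0 ^ 2) ^ 3) by ring.
      assert (0 <= x0 ^ 2) by apply pow2_ge_0. set (u := x0 ^ 2) in *.
      assert (0 <= (u + 10 / 9) * (u - 20 / 9) ^ 2) by (apply Rmult_le_pos; [lra|apply pow2_ge_0]).
      nra. }
    assert (Bar2 : eps * (30 * x0 ^ 4 - 6 * x0 ^ 6 - 3 * (x0 ^ 6 + 17)) <= 0) by nra.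
    replace (w1 x0) with (eps * (6 * x0 ^ 5)) in HM by lra.
    replace (x0 * (eps * (6 * x0 ^ 5))) with (eps * (6 * x0 ^ 6)) in HM by ring.
    lra. }
  assert (Hx := Hmax x ltac:(apply Rabs_between; exact HX2)).
  assert (z x = w x - e) by (unfold z, eps; field; lra).
  lra.
Qed.

Lemma max_principle (w w1 w2 : R -> R) (M A : R) :
  (forall x, is_derive w x (w1 x)) -> (forall x, is_derive w1 x (w2 x)) ->
  (forall x, Rabs (w2 x - x * w1 x - 3 * w x) <= M) ->
  (forall x, 1 <= Rabs x -> Rabs (w x) <= A * x ^ 4) ->
  forall x, Rabs (w x) <= M / 3.
Proof.
  intros D1 D2 HM HA x. apply Rabs_le. split.
  - assert (- w x <= M / 3); [|lra].
    apply (max_principle_upper (fun x => - w x) (fun x => - w1 x) (fun x => - w2 x) M A).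
    + intros; now apply (is_derive_opp w).
    + intros; now apply (is_derive_opp w1).
    + intros y. rewrite <- Rabs_Ropp.
      replace (- (- w2 y - y * - w1 y - 3 * - w y)) with (w2 y - y * w1 y - 3 * w y) by ring.
      apply HM.
    + intros y Hy. rewrite Rabs_Ropp. now apply HA.
  - now apply (max_principle_upper w w1 w2 M A).
Qed.

Lemma taylor2_of_derive (M : R) (f f1 f2 : R -> R) :
  (forall x, is_derive f x (f1 x)) -> (forall x, is_derive f1 x (f2 x)) ->
  (forall x, Rabs (f2 x) <= M) -> taylor2 M f f1.
Proof.
  intros D1 D2 H.
  assert (L : forall x y, Rabs (f1 (x + y) - f1 x) <= M * Rabs y).
  { intros x y. destruct (mvt f1 f2 x (x + y) D2) as [c [_ E]].
    rewrite E. replace (x + y - x) with y by ring. rewrite Rabs_mult.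
    apply Rmult_le_compat_r; [apply Rabs_pos|apply H]. }
  split; [|exact L]. intros x y.
  assert (M0 : 0 <= M) by (eapply Rle_trans; [apply Rabs_pos|apply (H 0)]).
  destruct (mvt f f1 x (x + y) D1) as [c [Hc E]].
  replace (f (x + y) - f x - y * f1 x) with (y * (f1 (x + (c - x)) - f1 x)).
  2: { rewrite E. replace (x + (c - x)) with c by ring. ring. }
  rewrite Rabs_mult, <- (pow2_abs y).
  assert (Hcx : Rabs (c - x) <= Rabs y).
  { revert Hc. unfold Rmin, Rmax. destruct (Rle_dec x (x + y)); intros Hc.
    - rewrite !Rabs_pos_eq; lra.
    - rewrite !Rabs_left1; lra. }
  specialize (L x (c - x)). pose proof (Rabs_pos y).
  assert (M * Rabs (c - x) <= M * Rabs y) by (apply Rmult_le_compat_l; assumption).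
  nra.
Qed.

Lemma growth_of_derive (f f1 : R -> R) (a b c : R) : 0 <= a -> 0 <= b -> 0 <= c ->
  (forall x, is_derive f x (f1 x)) ->
  (forall x, Rabs (f1 x) <= a + b * Rabs x + c * Rabs x ^ 2) ->
  forall x, Rabs (f x) <= Rabs (f 0) + a * Rabs x + b * Rabs x ^ 2 + c * Rabs x ^ 3.
Proof.
  intros Ha Hb Hc D H x. destruct (mvt f f1 0 x D) as [y [Hy E]].
  assert (Hyx : Rabs y <= Rabs x).
  { revert Hy. unfold Rmin, Rmax. destruct (Rle_dec 0 x); intros Hy.
    - rewrite !Rabs_pos_eq; lra.
    - rewrite !Rabs_left1; lra. }
  replace (f x) with (f 0 + f1 y * x) by lra.
  eapply Rle_trans; [apply Rabs_triang|]. rewrite Rabs_mult.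
  specialize (H y). pose proof (Rabs_pos y). pose proof (Rabs_pos x).
  assert (b * Rabs y <= b * Rabs x) by nra.
  assert (Rabs y ^ 2 <= Rabs x ^ 2) by (apply pow_incr; lra).
  assert (c * Rabs y ^ 2 <= c * Rabs x ^ 2) by nra.
  assert (Rabs (f1 y) * Rabs x <= (a + b * Rabs x + c * Rabs x ^ 2) * Rabs x) by (apply Rmult_le_compat_r; lra).
  nra.
Qed.

Section SteinEquation.
Variables h h1 h2 h3 : R -> R.
Variable M : R.
Hypothesis D1 : forall x, is_derive h x (h1 x).
Hypothesis D2 : forall x, is_derive h1 x (h2 x).
Hypothesis D3 : forall x, is_derive h2 x (h3 x).
Hypothesis HM : forall x, Rabs (h3 x) <= M.

Let M0 : 0 <= M.
Proof. eapply Rle_trans; [apply Rabs_pos|apply (HM 0)]. Qed.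

Lemma third_bounded_growth1 (x : R) :
  Rabs (h1 x) <= Rabs (h1 0) + Rabs (h2 0) * Rabs x + M * Rabs x ^ 2.
Proof.
  assert (G2 : forall x, Rabs (h2 x) <= Rabs (h2 0) + M * Rabs x + 0 * Rabs x ^ 2).
  { intros y. pose proof (growth_of_derive h2 h3 M 0 0 M0 ltac:(lra) ltac:(lra) D3) as G.
    specialize (G ltac:(intros t; specialize (HM t); lra) y). lra. }
  pose proof (growth_of_derive h1 h2 (Rabs (h2 0)) M 0 (Rabs_pos _) M0 ltac:(lra) D2 G2 x). lra.
Qed.

Lemma third_bounded_cubic : cubic h.
Proof.
  apply (cubic_poly (Rabs (h 0)) (Rabs (h1 0)) (Rabs (h2 0)) M).
  apply growth_of_derive with h1; auto using Rabs_pos, third_bounded_growth1.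
Qed.

Lemma third_bounded_cubic1 : cubic h1.
Proof.
  apply (cubic_poly (Rabs (h1 0)) (Rabs (h2 0)) M 0). intros x.
  pose proof (third_bounded_growth1 x). lra.
Qed.

Lemma stein_solution : exists f f1 : R -> R,
  taylor2 (M / 3) f f1 /\ forall x, f1 x - x * f x = h x - E_normal h.
Proof.
  set (N := E_normal h).
  assert (Ch : forall x, continuous h x) by (intros x; eapply is_derive_continuous; apply D1).
  set (k := fun x => h x - N).
  assert (Ck : forall x, continuous k x).
  { intros x. apply (continuous_minus (V := R_NormedModule) h (fun _ => N)); auto.
    apply continuous_const. }
  assert (Kc : cubic k) by (apply cubic_minus; [apply third_bounded_cubic|apply cubic_const]).
  destruct (RInt_lim_right k Ck Kc) as [Lp [Cp [HCp Hp]]].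
  destruct (RInt_lim_left k Ck Kc) as [Lm [Cm [HCm Hm]]].
  (* The two limits agree because [k] has mean zero under the normal law. *)
  assert (EL : Lp = Lm).
  { pose proof (is_RInt_gen_of_limits k Lp Lm Cp Cm Ck HCp HCm Hp Hm) as I1.
    destruct (RInt_lim_right h Ch third_bounded_cubic) as [P [CP [HCP HP]]].
    destruct (RInt_lim_left h Ch third_bounded_cubic) as [Q [CQ [HCQ HQ]]].
    pose proof (is_RInt_gen_of_limits h P Q CP CQ Ch HCP HCQ HP HQ) as I2.
    assert (EN : N = P - Q) by (apply is_RInt_gen_unique; exact I2).
    rewrite <- EN in I2.
    pose proof (is_RInt_gen_minus (V := R_NormedModule) _ _ _ _ I2
      (is_RInt_gen_scal (V := R_NormedModule) _ N _ phi_integral)) as I3.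
    assert (I4 : is_RInt_gen (fun t => k t * phi t) (Rbar_locally m_infty) (Rbar_locally p_infty)
       (minus N (scal N 1))).
    { eapply is_RInt_gen_ext; [|exact I3]. apply filter_forall. intros ab x _.
      unfold minus, plus, opp, scal; simpl; unfold mult; simpl. unfold k. ring. }
    pose proof (is_RInt_gen_unique _ _ I1) as U1.
    pose proof (is_RInt_gen_unique _ _ I4) as U4.
    rewrite U1 in U4. unfold minus, plus, opp, scal in U4; simpl in U4; unfold mult in U4; simpl in U4.
    lra. }
  set (K := fun x => RInt (fun t => k t * phi t) 0 x).
  assert (DK : forall x, is_derive K x (k x * phi x)).
  { intros x. apply (is_derive_RInt (fun t => k t * phi t) K 0 x).
    - apply filter_forall. intros y. apply @RInt_correct, ex_RInt_phi_mul, Ck.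
    - apply continuous_Rmult; [apply Ck|apply continuous_phi]. }
  (* Solutions differ by multiples of [1 / phi]; subtracting the common limit selects the one of
     polynomial growth. *)
  set (f := fun x => (K x - Lm) / phi x).
  (* The successive derivatives of [f] are read off by differentiating the Stein equation, so that
     the equation for [f2] holds by mere expansion of [f4]. *)
  set (f1 := fun x => x * f x + (h x - N)).
  set (f2 := fun x => f x + x * f1 x + h1 x).
  set (f3 := fun x => 2 * f1 x + x * f2 x + h2 x).
  set (f4 := fun x => 3 * f2 x + x * f3 x + h3 x).
  assert (Fd : forall x, is_derive f x (f1 x)).
  { intros x. assert (Hphi := phi_pos x).
    replace (f1 x) with ((k x * phi x * phi x - (K x - Lm) * (- x * phi x)) / (phi x) ^ 2).
    2: { unfold f1, f, k. field. lra. }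
    apply (is_derive_div (fun x => K x - Lm) phi x (k x * phi x) (- x * phi x)).
    - replace (k x * phi x) with (minus (k x * phi x) 0).
      2: { unfold minus, plus, opp; simpl. ring. }
      apply (is_derive_minus K (fun _ => Lm)); [apply DK|apply @is_derive_const].
    - apply is_derive_phi.
    - lra. }
  assert (Fd1 : forall x, is_derive f1 x (f2 x)).
  { intros x. unfold f1.
    replace (f2 x) with ((1 * f x + x * f1 x) + (h1 x - 0)) by (unfold f2; ring).
    apply (is_derive_plus (fun x => x * f x) (fun x => h x - N)).
    - apply (is_derive_mult (fun x => x) f x 1 (f1 x)); [apply @is_derive_id|apply Fd|].
      intros; apply Rmult_comm.
    - apply (is_derive_minus h (fun _ => N)); [apply D1|apply @is_derive_const]. }
  assert (Fd2 : forall x, is_derive f2 x (f3 x)).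
  { intros x. unfold f2.
    replace (f3 x) with ((f1 x + (1 * f1 x + x * f2 x)) + h2 x) by (unfold f3; ring).
    apply (is_derive_plus (fun x => f x + x * f1 x) h1); [|apply D2].
    apply (is_derive_plus f (fun x => x * f1 x)); [apply Fd|].
    apply (is_derive_mult (fun x => x) f1 x 1 (f2 x)); [apply @is_derive_id|apply Fd1|].
    intros; apply Rmult_comm. }
  assert (Fd3 : forall x, is_derive f3 x (f4 x)).
  { intros x. unfold f3.
    replace (f4 x) with ((2 * f2 x + (1 * f2 x + x * f3 x)) + h3 x) by (unfold f4; ring).
    apply (is_derive_plus (fun x => 2 * f1 x + x * f2 x) h2); [|apply D3].
    apply (is_derive_plus (fun x => 2 * f1 x) (fun x => x * f2 x)).
    - apply is_derive_scal, Fd1.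
    - apply (is_derive_mult (fun x => x) f2 x 1 (f3 x)); [apply @is_derive_id|apply Fd2|].
      intros; apply Rmult_comm. }
  exists f, f1. split; [|intros x; unfold f1; ring].
  apply taylor2_of_derive with f2; auto.
  (* Since [tail / phi] is [x ^ 2 + 3], the function [f2], which is [(1 + x ^ 2) * f] plus terms in
     [k] and [h1], grows at most like [x ^ 4], as the maximum principle demands. *)
  assert (Gf : forall x, 1 <= Rabs x -> Rabs (f x) <= (Cp + Cm) * (x ^ 2 + 3)).
  { intros x Hx. assert (Hphi := phi_pos x).
    assert (T : Rabs (K x - Lm) <= (Cp + Cm) * tail x).
    { pose proof (tail_nonneg x). rewrite Rabs_minus_sym.
      destruct (Rle_dec 0 x) as [S|S].
      - rewrite Rabs_pos_eq in Hx by assumption. rewrite <- EL.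
        eapply Rle_trans; [apply Hp; assumption|]. nra.
      - rewrite Rabs_left1 in Hx by lra.
        eapply Rle_trans; [apply Hm; lra|]. nra. }
    unfold f, Rdiv. rewrite Rabs_mult, Rabs_inv, (Rabs_pos_eq (phi x)) by lra.
    apply (Rle_div_l _ _ (phi x)); [assumption|]. unfold tail in T. lra. }
  destruct Kc as [A HA]. destruct third_bounded_cubic1 as [A1 HA1].
  assert (C8 : forall x, 1 <= Rabs x -> (1 + Rabs x) ^ 3 <= 8 * Rabs x ^ 3).
  { intros x Hx. replace (8 * Rabs x ^ 3) with ((2 * Rabs x) ^ 3) by ring.
    apply pow_incr. lra. }
  assert (A0 : 0 <= A).
  { specialize (HA 0). rewrite Rabs_R0 in HA. pose proof (Rabs_pos (k 0)). lra. }
  assert (A10 : 0 <= A1).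
  { specialize (HA1 0). rewrite Rabs_R0 in HA1. pose proof (Rabs_pos (h1 0)). lra. }
  apply (max_principle f2 f3 f4 M (8 * (Cp + Cm) + 8 * A + 8 * A1)); auto.
  - intros x. replace (f4 x - x * f3 x - 3 * f2 x) with (h3 x) by (unfold f4; ring). apply HM.
  - intros x Hx. specialize (Gf x Hx). specialize (C8 x Hx).
    replace (f2 x) with ((1 + x ^ 2) * f x + x * k x + h1 x) by (unfold f2, f1, k; ring).
    assert (E4 : x ^ 4 = Rabs x ^ 4).
    { replace (x ^ 4) with ((x ^ 2) ^ 2) by ring. rewrite <- (pow2_abs x). ring. }
    assert (E2 : x ^ 2 = Rabs x ^ 2) by (now rewrite pow2_abs).
    assert (B1 : Rabs ((1 + x ^ 2) * f x) <= 8 * (Cp + Cm) * x ^ 4).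
    { rewrite Rabs_mult, (Rabs_pos_eq (1 + x ^ 2)) by (pose proof (pow2_ge_0 x); lra).
      assert (1 <= x ^ 2) by (rewrite E2; nra).
      replace (x ^ 4) with (x ^ 2 * x ^ 2) by ring. set (u := x ^ 2) in *.
      apply Rle_trans with ((1 + u) * ((Cp + Cm) * (u + 3))).
      - apply Rmult_le_compat_l; lra.
      - assert ((1 + u) * (u + 3) <= 8 * (u * u)) by nra. nra. }
    assert (B2 : Rabs (x * k x) <= 8 * A * x ^ 4).
    { rewrite Rabs_mult, E4. specialize (HA x).
      assert (Rabs (k x) <= A * (8 * Rabs x ^ 3)) by nra.
      apply Rle_trans with (Rabs x * (A * (8 * Rabs x ^ 3))).
      - apply Rmult_le_compat_l; [apply Rabs_pos|assumption].
      - apply Req_le. ring. }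
    assert (B3 : Rabs (h1 x) <= 8 * A1 * x ^ 4).
    { rewrite E4. specialize (HA1 x).
      assert (Rabs x ^ 3 <= Rabs x ^ 4) by (apply Rle_pow; [assumption|lia]).
      nra. }
    pose proof (Rabs_triang ((1 + x ^ 2) * f x + x * k x) (h1 x)).
    pose proof (Rabs_triang ((1 + x ^ 2) * f x) (x * k x)). lra.
Qed.

End SteinEquation.

(** * Normal approximation *)

Section Comparison.
Variable b : nat.
Hypothesis hb : (2 <= b)%nat.

Lemma sigma_pos (r : nat) : (1 <= r)%nat -> 0 < sigma b r.
Proof.
  intros Hr. unfold sigma. rewrite var_mu_Vmu by assumption. apply sqrt_lt_R0.
  pose proof (rho_le_Vmu b hb r Hr). pose proof (rho_pos b hb r Hr). lra.
Qed.

Lemma sqrt_rho_le (r : nat) : (1 <= r)%nat -> sqrt (INR (rho b r)) <= 2 * sigma b r.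
Proof.
  intros Hr. unfold sigma. rewrite var_mu_Vmu by assumption.
  pose proof (rho_le_Vmu b hb r Hr). pose proof (Vmu_nonneg b hb r).
  replace 2 with (sqrt (2 * 2)) by (apply sqrt_square; lra).
  rewrite <- sqrt_mult by lra. apply sqrt_le_1_alt. lra.
Qed.

Lemma stein_const_pos : 0 < stein_const b.
Proof.
  unfold stein_const. pose proof (Emu_1_cube_nonneg b hb).
  assert (0 < INR b) by (apply lt_0_INR; lia). lra.
Qed.

(** For [F x = f (x / s)] the second derivative scales by [s ^ (-2)], which cancels the variance
    [s ^ 2] in the Stein bound. What is left is the prefactor [1 / s], of order [1 / sqrt rho]. *)
Lemma smooth_comparison (h h1 h2 h3 : R -> R) (M : R) (r : nat) :
  (forall x, is_derive h x (h1 x)) -> (forall x, is_derive h1 x (h2 x)) ->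
  (forall x, is_derive h2 x (h3 x)) -> (forall x, Rabs (h3 x) <= M) -> (1 <= r)%nat ->
  Rabs (E_tilde b r h - E_normal h) <= stein_const b * M / sqrt (INR (rho b r)).
Proof.
  intros D1 D2 D3 HM Hr.
  assert (M0 : 0 <= M) by (eapply Rle_trans; [apply Rabs_pos|apply (HM 0)]).
  destruct (stein_solution h h1 h2 h3 M D1 D2 D3 HM) as [f [f1 [Hf Eq]]].
  pose proof (third_bounded_cubic h h1 h2 h3 M D1 D2 D3 HM) as Hc.
  pose proof (sigma_pos r Hr) as Hs.
  assert (Es : sigma b r ^ 2 = Vmu b r).
  { unfold sigma. rewrite var_mu_Vmu by assumption. apply pow2_sqrt, Vmu_nonneg, hb. }
  set (s := sigma b r) in *.
  set (F := fun x => f (x / s)). set (F1 := fun x => f1 (x / s) / s).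
  assert (HF : taylor2 (M / 3 / s ^ 2) F F1).
  { destruct Hf as [T1 T2]. split; intros x y; unfold F, F1.
    - replace ((x + y) / s) with (x / s + y / s) by (field; lra).
      replace (y * (f1 (x / s) / s)) with (y / s * f1 (x / s)) by (field; lra).
      replace (M / 3 / s ^ 2 * y ^ 2) with (M / 3 * (y / s) ^ 2) by (field; lra). apply T1.
    - replace ((x + y) / s) with (x / s + y / s) by (field; lra).
      replace (f1 (x / s + y / s) / s - f1 (x / s) / s)
        with ((f1 (x / s + y / s) - f1 (x / s)) / s) by (field; lra).
      unfold Rdiv at 1. rewrite Rabs_mult, Rabs_inv, (Rabs_pos_eq s) by lra.
      apply (Rle_div_l _ _ s); [assumption|].
      replace (M / 3 / s ^ 2 * Rabs y * s) with (M / 3 * Rabs (y / s)).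
      + apply T2.
      + unfold Rdiv at 2. rewrite Rabs_mult, Rabs_inv, (Rabs_pos_eq s) by lra. field. lra. }
  pose proof (Emu_stein b hb r _ F F1 HF) as HS.
  assert (EE : E_tilde b r h - E_normal h
    = / s * (Vmu b r * Emu b r F1 - Emu b r (fun x => x * F x))).
  { change (E_tilde b r h) with (Emu b r (fun x => h (x / s))).
    rewrite <- (Emu_const b hb r (E_normal h)).
    assert (Hc' : cubic (fun x => h (x / s))).
    { apply cubic_ext with (fun x => h (/ s * x + 0)); [|now apply cubic_affine].
      intros x; f_equal; field; lra. }
    rewrite <- Emu_minus by auto using cubic_const.
    rewrite <- Emu_scal, <- Emu_minus, <- Emu_scal; auto.
    - apply Emu_ext. intros x. rewrite <- Eq. unfold F, F1. rewrite <- Es. field. lra.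
    - apply cubic_scal. apply (lipschitz_cubic _ _ (proj2 HF)).
    - apply (taylor2_cubic_mul _ _ _ HF). }
  rewrite EE, Rabs_mult, Rabs_inv, (Rabs_pos_eq s) by lra.
  pose proof (sqrt_rho_le r Hr) as Hrho. fold s in Hrho.
  pose proof stein_const_pos as HC.
  assert (Hq : 0 < sqrt (INR (rho b r))).
  { apply sqrt_lt_R0. pose proof (rho_pos b hb r Hr). lra. }
  apply Rle_trans with (/ s * (stein_const b * (M / 3))).
  - apply Rmult_le_compat_l; [apply Rlt_le, Rinv_0_lt_compat; assumption|].
    replace (stein_const b * (M / 3)) with (stein_const b * (M / 3 / s ^ 2) * Vmu b r); [exact HS|].
    rewrite <- Es. field. lra.
  - apply (Rle_div_r _ _ (sqrt (INR (rho b r)))); [assumption|].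
    replace (/ s * (stein_const b * (M / 3)) * sqrt (INR (rho b r)))
      with (stein_const b * (M / 3) * sqrt (INR (rho b r)) / s) by (field; lra).
    apply Rle_div_l; [assumption|].
    assert (0 <= stein_const b * M) by nra. nra.
Qed.

End Comparison.

(** * Smoothing the indicator of a half-line *)

Definition clamp (y : R) : R := Rmax 0 (Rmin 1 y).

Lemma clamp_bounds (y : R) : 0 <= clamp y <= 1.
Proof. unfold clamp, Rmax, Rmin. destruct (Rle_dec 1 y), (Rle_dec 0 _); lra. Qed.

Lemma clamp_id (y : R) : 0 <= y <= 1 -> clamp y = y.
Proof. intros H. unfold clamp, Rmax, Rmin. destruct (Rle_dec 1 y), (Rle_dec 0 _); lra. Qed.

Lemma clamp_low (y : R) : y <= 0 -> clamp y = 0.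
Proof. intros H. unfold clamp, Rmax, Rmin. destruct (Rle_dec 1 y), (Rle_dec 0 _); lra. Qed.

Lemma clamp_high (y : R) : 1 <= y -> clamp y = 1.
Proof. intros H. unfold clamp, Rmax, Rmin. destruct (Rle_dec 1 y), (Rle_dec 0 _); lra. Qed.

Lemma clamp_contract (x y : R) : Rabs (clamp x - clamp y) <= Rabs (x - y).
Proof.
  unfold clamp, Rmax, Rmin. destruct (Rle_dec 1 x), (Rle_dec 1 y);
  repeat match goal with |- context [Rle_dec ?u ?v] => destruct (Rle_dec u v) end;
  apply Rabs_le; unfold Rabs; destruct (Rcase_abs (x - y)); lra.
Qed.

(** [clamp] has corners at 0 and 1, but it is 1-Lipschitz, so increments of [P] that are [o(v)]
    remain [o(u)] after composition. *)
Lemma is_derive_clamp_crit (P : R -> R) (x : R) :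
  is_derive P (clamp x) 0 -> is_derive (fun y => P (clamp y)) x 0.
Proof.
  intros H. apply is_derive_Reals. apply is_derive_Reals in H.
  intros eps Heps. destruct (H eps Heps) as [d Hd]. exists d. intros u Hu Hud.
  rewrite Rminus_0_r. pose proof (clamp_contract (x + u) x) as C.
  replace (x + u - x) with u in C by ring.
  destruct (Req_dec (clamp (x + u) - clamp x) 0) as [E|E].
  - replace (clamp (x + u)) with (clamp x) by lra.
    unfold Rdiv. rewrite Rminus_diag, Rmult_0_l, Rabs_R0. exact Heps.
  - specialize (Hd (clamp (x + u) - clamp x) E ltac:(lra)).
    rewrite Rminus_0_r in Hd.
    replace (clamp x + (clamp (x + u) - clamp x)) with (clamp (x + u)) in Hd by ring.
    set (v := clamp (x + u) - clamp x) in *. set (w := P (clamp (x + u)) - P (clamp x)) in *.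
    unfold Rdiv in *. rewrite Rabs_mult, Rabs_inv in *.
    assert (Hu' := Rabs_pos_lt u Hu). assert (Hv := Rabs_pos_lt v E).
    apply (Rlt_div_l _ _ (Rabs u)); [assumption|].
    apply (Rlt_div_l _ _ (Rabs v)) in Hd; [|assumption].
    nra.
Qed.

Lemma is_derive_clamp (P P1 : R -> R) (x : R) :
  (forall y, is_derive P y (P1 y)) -> P1 0 = 0 -> P1 1 = 0 ->
  is_derive (fun y => P (clamp y)) x (P1 (clamp x)).
Proof.
  intros H H0 H1.
  destruct (Rle_dec x 0) as [L|L].
  { rewrite (clamp_low x L), H0. apply is_derive_clamp_crit.
    rewrite (clamp_low x L). pose proof (H 0) as D. now rewrite H0 in D. }
  destruct (Rle_dec 1 x) as [G|G].
  { rewrite (clamp_high x G), H1. apply is_derive_clamp_crit.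
    rewrite (clamp_high x G). pose proof (H 1) as D. now rewrite H1 in D. }
  rewrite (clamp_id x) by lra.
  apply is_derive_ext_loc with P; [|apply H].
  assert (Hd : 0 < Rmin x (1 - x)) by (apply Rmin_pos; lra).
  exists (mkposreal _ Hd). intros y Hy.
  change (Rabs (y - x) < Rmin x (1 - x)) in Hy.
  pose proof (Rmin_l x (1 - x)). pose proof (Rmin_r x (1 - x)).
  apply Rabs_lt_between in Hy. rewrite clamp_id; [reflexivity|lra].
Qed.

(* The step of degree 7 whose first three derivatives vanish at 0 and at 1. *)
Definition step0 (y : R) : R := 35 * y ^ 4 - 84 * y ^ 5 + 70 * y ^ 6 - 20 * y ^ 7.
Definition step1 (y : R) : R := 140 * y ^ 3 - 420 * y ^ 4 + 420 * y ^ 5 - 140 * y ^ 6.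
Definition step2 (y : R) : R := 420 * y ^ 2 - 1680 * y ^ 3 + 2100 * y ^ 4 - 840 * y ^ 5.
Definition step3 (y : R) : R := 840 * y - 5040 * y ^ 2 + 8400 * y ^ 3 - 4200 * y ^ 4.

Lemma step0_nonneg (y : R) : 0 <= y <= 1 -> 0 <= step0 y.
Proof.
  (* [step0 y] is the probability of at least four successes in seven trials of success probability
     [y]. The factored form sorts by the number of failures before the fourth success. *)
  intros Hy. replace (step0 y)
    with (y ^ 4 * (1 + 4 * (1 - y) + 10 * (1 - y) ^ 2 + 20 * (1 - y) ^ 3))
    by (unfold step0; ring).
  assert (0 <= (1 - y) ^ 2) by (apply pow_le; lra).
  assert (0 <= (1 - y) ^ 3) by (apply pow_le; lra).
  apply Rmult_le_pos; [apply pow_le; lra|lra].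
Qed.

Lemma step0_bounds (y : R) : 0 <= y <= 1 -> 0 <= step0 y <= 1.
Proof.
  intros Hy. split; [now apply step0_nonneg|].
  pose proof (step0_nonneg (1 - y) ltac:(lra)) as H.
  replace (step0 (1 - y)) with (1 - step0 y) in H by (unfold step0; ring). lra.
Qed.

(** The constant is the sum of the absolute values of the coefficients. *)
Lemma step3_bound (y : R) : 0 <= y <= 1 -> Rabs (step3 y) <= 18480.
Proof.
  intros Hy. assert (P : forall n, 0 <= y ^ n <= 1).
  { intros n. split; [apply pow_le; lra|apply pow_le_1; lra]. }
  pose proof (P 2%nat). pose proof (P 3%nat). pose proof (P 4%nat).
  apply Rabs_le. unfold step3. lra.
Qed.

(** A smooth function between the indicators of [x <= s] and of [x <= s + e]. *)
Definition ramp (s e x : R) : R := step0 (clamp ((s + e - x) / e)).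

Lemma is_derive_affine (g g1 : R -> R) (s e x : R) : 0 < e ->
  (forall y, is_derive g y (g1 y)) ->
  is_derive (fun x => g ((s + e - x) / e)) x (- / e * g1 ((s + e - x) / e)).
Proof.
  intros He H. apply (is_derive_comp g (fun x => (s + e - x) / e)); [apply H|].
  auto_derive; [trivial|]. field. lra.
Qed.

Lemma ramp_derivatives (s e : R) : 0 < e -> exists h1 h2 h3 : R -> R,
  (forall x, is_derive (ramp s e) x (h1 x)) /\ (forall x, is_derive h1 x (h2 x)) /\
  (forall x, is_derive h2 x (h3 x)) /\ (forall x, Rabs (h3 x) <= 18480 / e ^ 3).
Proof.
  intros He.
  assert (C0 : forall y, is_derive (fun y => step0 (clamp y)) y (step1 (clamp y))).
  { intros y. apply is_derive_clamp; try (unfold step1; ring).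
    intros z. unfold step0, step1. auto_derive; [trivial|]. ring. }
  assert (C1 : forall y, is_derive (fun y => step1 (clamp y)) y (step2 (clamp y))).
  { intros y. apply is_derive_clamp; try (unfold step2; ring).
    intros z. unfold step1, step2. auto_derive; [trivial|]. ring. }
  assert (C2 : forall y, is_derive (fun y => step2 (clamp y)) y (step3 (clamp y))).
  { intros y. apply is_derive_clamp; try (unfold step3; ring).
    intros z. unfold step2, step3. auto_derive; [trivial|]. ring. }
  set (l := fun x => (s + e - x) / e).
  exists (fun x => - / e * step1 (clamp (l x))),
    (fun x => - / e * (- / e * step2 (clamp (l x)))),
    (fun x => - / e * (- / e * (- / e * step3 (clamp (l x))))).
  split; [|split; [|split]].
  - intros x. apply (is_derive_affine (fun y => step0 (clamp y)) (fun y => step1 (clamp y))); auto.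
  - intros x. apply is_derive_scal.
    apply (is_derive_affine (fun y => step1 (clamp y)) (fun y => step2 (clamp y))); auto.
  - intros x. apply is_derive_scal, is_derive_scal.
    apply (is_derive_affine (fun y => step2 (clamp y)) (fun y => step3 (clamp y))); auto.
  - intros x. pose proof (step3_bound _ (clamp_bounds (l x))) as H.
    replace (- / e * (- / e * (- / e * step3 (clamp (l x)))))
      with (- step3 (clamp (l x)) / e ^ 3) by (field; lra).
    unfold Rdiv at 1. rewrite Rabs_mult, Rabs_Ropp, Rabs_inv, (Rabs_pos_eq (e ^ 3))
      by (apply pow_le; lra).
    apply Rmult_le_compat_r; [|assumption]. apply Rlt_le, Rinv_0_lt_compat, pow_lt; assumption.
Qed.

Lemma ramp_bounds (s e x : R) : 0 <= ramp s e x <= 1.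
Proof. apply step0_bounds, clamp_bounds. Qed.

Lemma ramp_left (s e x : R) : 0 < e -> x <= s -> ramp s e x = 1.
Proof.
  intros He Hx. unfold ramp. rewrite clamp_high; [unfold step0; ring|].
  apply (Rle_div_r 1 _ e); lra.
Qed.

Lemma ramp_right (s e x : R) : 0 < e -> s + e <= x -> ramp s e x = 0.
Proof.
  intros He Hx. unfold ramp. rewrite clamp_low; [unfold step0; ring|].
  apply (Rle_div_l _ 0 e); lra.
Qed.

Lemma is_RInt_gen_F_normal (t : R) :
  is_RInt_gen phi (Rbar_locally m_infty) (at_point t) (F_normal t).
Proof.
  assert (Hk : forall z : R, continuous (fun _ : R => 1) z) by (intros; apply continuous_const).
  destruct (RInt_lim_left (fun _ => 1) Hk (cubic_const 1)) as [L [C [HC H]]].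
  assert (G : is_RInt_gen phi (Rbar_locally m_infty) (at_point t) (Gint t - L)).
  { intros P [eps HP].
    destruct (tail_lt_eventually C eps HC) as [X [X1 HX]].
    apply Filter_prod with (fun x => x < - X) (fun y => y = t).
    - now exists (- X).
    - reflexivity.
    - intros x y Hx ->. exists (RInt phi x t).
      assert (Xp : forall u v, ex_RInt phi u v).
      { intros u v. apply @ex_RInt_continuous. intros; apply continuous_phi. }
      split; [apply @RInt_correct, Xp|]. apply HP.
      specialize (HX x ltac:(rewrite Rabs_left1; lra)).
      specialize (H x ltac:(lra)). rewrite Gint_phi_form in H.
      pose proof (RInt_Chasles (V := R_CompleteNormedModule) phi 0 x t (Xp _ _) (Xp _ _)) as E.
      change (Gint x + RInt phi x t = Gint t) in E.
      change (Rabs (RInt phi x t - (Gint t - L)) < eps).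
      replace (RInt phi x t - (Gint t - L)) with (L - Gint x) by lra. lra. }
  unfold F_normal. rewrite (is_RInt_gen_unique _ _ G). exact G.
Qed.

(** All three quantities differ by at most the normal mass of [[s, s + e]], which is at most [e]
    because [phi <= 1]. *)
Lemma normal_ramp (s e : R) : 0 < e ->
  Rabs (E_normal (ramp s e) - F_normal s) <= e /\
  Rabs (E_normal (ramp s e) - F_normal (s + e)) <= e.
Proof.
  intros He. destruct (ramp_derivatives s e He) as [h1 [_ [_ [D1 _]]]].
  assert (Cr : forall x, continuous (ramp s e) x)
    by (intros x; eapply is_derive_continuous; apply D1).
  assert (Xp : forall u v, ex_RInt phi u v).
  { intros u v. apply @ex_RInt_continuous. intros; apply continuous_phi. }
  set (g := fun x => ramp s e x * phi x).
  assert (Xg : forall u v, ex_RInt g u v) by (intros; now apply ex_RInt_phi_mul).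
  set (v := RInt g s (s + e)). set (u := RInt phi s (s + e)).
  assert (Hv : 0 <= v <= u).
  { split.
    - apply RInt_ge_0; [lra|apply Xg|]. intros x _. unfold g.
      pose proof (ramp_bounds s e x). pose proof (phi_pos x). nra.
    - apply RInt_le; [lra|apply Xg|apply Xp|]. intros x _. unfold g.
      pose proof (ramp_bounds s e x). pose proof (phi_pos x). nra. }
  assert (Hu : u <= e).
  { apply Rle_trans with (RInt (fun _ => 1) s (s + e)).
    - apply RInt_le; [lra|apply Xp|apply ex_RInt_const|]. intros; apply phi_le_1.
    - rewrite RInt_const. unfold scal; simpl; unfold mult; simpl. lra. }
  assert (EF : F_normal (s + e) = F_normal s + u).
  { unfold F_normal at 1. apply is_RInt_gen_unique.
    apply (is_RInt_gen_Chasles (V := R_NormedModule) phi s (F_normal s) u (Fa := Rbar_locally m_infty)).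
    - apply is_RInt_gen_F_normal.
    - apply is_RInt_gen_at_point, @RInt_correct, Xp. }
  assert (EE : E_normal (ramp s e) = F_normal s + v).
  { unfold E_normal. apply is_RInt_gen_unique. fold g.
    apply (is_RInt_gen_Chasles (V := R_NormedModule) g s (F_normal s) v (Fa := Rbar_locally m_infty)).
    - eapply is_RInt_gen_ext; [|apply is_RInt_gen_F_normal].
      apply Filter_prod with (fun x => x < s) (fun y => y = s).
      + now exists s.
      + reflexivity.
      + intros x y Hx -> z Hz. simpl in Hz. rewrite Rmax_right in Hz by lra.
        unfold g. rewrite ramp_left; lra.
    - replace v with (plus v 0) by (unfold plus; simpl; ring).
      apply (is_RInt_gen_Chasles (V := R_NormedModule) g (s + e) v 0).
      + apply is_RInt_gen_at_point, @RInt_correct, Xg.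
      + intros P [eps HP].
        apply Filter_prod with (fun x => x = s + e) (fun y => s + e < y).
        * reflexivity.
        * now exists (s + e).
        * intros x y -> Hy. exists 0. split; [|apply HP, ball_center].
          apply is_RInt_ext with (fun _ => 0).
          -- intros z Hz. simpl in Hz. rewrite Rmin_left in Hz by lra.
             unfold g. rewrite ramp_right; [symmetry; apply Rmult_0_l|assumption|lra].
          -- pose proof (is_RInt_const (V := R_NormedModule) (s + e) y 0) as I0.
             change (scal (y - (s + e)) 0) with ((y - (s + e)) * 0) in I0.
             now rewrite Rmult_0_r in I0. }
  rewrite EF, EE. split; apply Rabs_le; lra.
Qed.

(** * The Kolmogorov distance *)

Section Kolmogorov.
Variable b : nat.
Hypothesis hb : (2 <= b)%nat.

Lemma ramp_cubic (s e : R) : cubic (ramp s e).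
Proof.
  apply (cubic_poly 1 0 0 0). intros x. pose proof (ramp_bounds s e x).
  rewrite Rabs_pos_eq; lra.
Qed.

Lemma F_tilde_bounds (r : nat) (s e : R) : (1 <= r)%nat -> 0 < e ->
  F_tilde b r s <= E_tilde b r (ramp s e) /\ E_tilde b r (ramp s e) <= F_tilde b r (s + e).
Proof.
  intros Hr He. pose proof (sigma_pos b hb r Hr) as Hs.
  assert (XE : ex_zsum (fun d => mu b r d * ramp s e (IZR d / sigma b r))).
  { apply (ex_Emu b hb r (fun x => ramp s e (x / sigma b r))).
    apply cubic_ext with (fun x => ramp s e (/ sigma b r * x + 0));
      [intros; f_equal; field; lra|]. apply cubic_affine, ramp_cubic. }
  assert (XF : forall t, ex_zsum (fun d => if Rle_dec (IZR d / sigma b r) t then mu b r d else 0)).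
  { intros t. apply ex_zsum_le with (fun d => mu b r d * 1).
    - intros d. pose proof (mu_nonneg b r d hb).
      destruct (Rle_dec _ _); [rewrite Rabs_pos_eq|rewrite Rabs_R0]; lra.
    - apply (ex_Emu b hb r (fun _ => 1)), cubic_const. }
  split; apply zsum_le; auto; intros d; pose proof (mu_nonneg b r d hb);
    pose proof (ramp_bounds s e (IZR d / sigma b r)); destruct (Rle_dec _ _) as [L|L].
  - rewrite ramp_left; lra.
  - nra.
  - nra.
  - rewrite ramp_right; lra.
Qed.

(** The ramp that starts at [t] bounds [F_tilde] from above, the one that ends at [t] from below.
    The smoothing width is paid for on the normal side, where the density is bounded. *)
Lemma kolmogorov_bound (r : nat) (t e : R) : (1 <= r)%nat -> 0 < e ->
  Rabs (F_tilde b r t - F_normal t)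
  <= e + stein_const b * (18480 / e ^ 3) / sqrt (INR (rho b r)).
Proof.
  intros Hr He.
  assert (S : forall s, Rabs (E_tilde b r (ramp s e) - E_normal (ramp s e))
    <= stein_const b * (18480 / e ^ 3) / sqrt (INR (rho b r))).
  { intros s. destruct (ramp_derivatives s e He) as [h1 [h2 [h3 [D1 [D2 [D3 HM]]]]]].
    now apply (smooth_comparison b hb (ramp s e) h1 h2 h3). }
  pose proof (S t) as S1. pose proof (S (t - e)) as S2.
  destruct (normal_ramp t e He) as [N1 _]. destruct (normal_ramp (t - e) e He) as [_ N2].
  destruct (F_tilde_bounds r t e Hr He) as [B1 _].
  destruct (F_tilde_bounds r (t - e) e Hr He) as [_ B2].
  replace (t - e + e) with t in * by ring.
  apply Rabs_between in S1, S2, N1, N2. apply Rabs_le. lra.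
Qed.

End Kolmogorov.

Theorem theorem3 : forall b : nat, (2 <= b)%nat ->
  (* (i) *)
  (forall h : R -> R,
     (forall (k : nat) (x : R), (k < 3)%nat -> ex_derive_n h (S k) x) ->
     (exists M, forall x, Rabs (Derive_n h 3 x) <= M) ->
     exists C R0 : R, forall r : nat, (1 <= r)%nat -> R0 <= INR (rho b r) ->
       Rabs (E_tilde b r h - E_normal h) <= C / sqrt (INR (rho b r)))
  /\
  (* (ii) *)
  (exists K : R, 0 < K /\
     forall r : nat, (1 <= r)%nat -> forall t : R,
       Rabs (F_tilde b r t - F_normal t) <= K / Rpower (INR (rho b r)) (1 / 8)).
Proof.
  intros b hb. split.
  (* The estimate holds for all [r >= 1], hence the threshold 0. *)
  - intros h Hd [M HM]. exists (stein_const b * M), 0. intros r Hr _.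
    apply (smooth_comparison b hb h (Derive_n h 1) (Derive_n h 2) (Derive_n h 3)); auto.
    + intros x. apply Derive_correct. exact (Hd 0%nat x ltac:(lia)).
    + intros x. apply (Derive_correct (Derive_n h 1)). exact (Hd 1%nat x ltac:(lia)).
    + intros x. apply (Derive_correct (Derive_n h 2)). exact (Hd 2%nat x ltac:(lia)).
  - pose proof (stein_const_pos b hb) as HC.
    (* The width [e = 1 / q] with [q = rho ^ (1/8)] balances the two errors: [sqrt rho = q ^ 4], so
       [e ^ (-3) / sqrt rho = 1 / q = e]. *)
    exists (1 + stein_const b * 18480). split; [lra|]. intros r Hr t.
    pose proof (rho_pos b hb r Hr) as Hrho. set (n := INR (rho b r)) in *.
    set (q := Rpower n (1 / 8)).
    assert (Hq : 0 < q) by apply exp_pos.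
    assert (Hq4 : sqrt n = q ^ 4).
    { rewrite <- Rpower_pow by assumption. unfold q. rewrite Rpower_mult.
      replace (1 / 8 * INR 4) with (/ 2) by (simpl; field).
      symmetry. apply Rpower_sqrt. lra. }
    eapply Rle_trans; [apply (kolmogorov_bound b hb r t (/ q) Hr)|].
    + now apply Rinv_0_lt_compat.
    + fold n. rewrite Hq4. apply Req_le. field. lra.
Qed.
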